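(* Let $(M,X)$ be a tracially complete $C^*$-algebra, and let $I_1,I_2,I_3,I_1',I_2',I_3'$ be sets. Suppose that $a\in M^{I_1}$, $b\in M^{I_2}$, $c\in M^{I_3}$ and $a'\in M^{I_1'}$, $b'\in M^{I_2'}$, $c'\in M^{I_3'}$ are given, and that $$C^*_X(b)\supseteq C^*_X(b'),\qquad C^*_X(a,b)\subseteq C^*_X(a',b'),\qquad C^*_X(a,b,c)\supseteq C^*_X(a',b',c').$$ Then $$\delta_{MD}(a|b:c)\le\delta_{MD}(a'|b':c').$$
   Context: A tracially complete $C^*$-algebra is a pair $(M,X)$ with $M$ a unital $C^*$-algebra and $X$ a weak$^*$-compact convex set of tracial states on $M$ such that $\|x\|_{2;X}=\sup_{\tau\in X}\tau(x^*x)^{1/2}$ is a norm under which the closed operator-norm unit ball of $M$ is complete. $\mathbb{C}^*\langle(T_i)_{i\in I}\rangle$ is the free unital $*$-algebra on $I$ (noncommutative $*$-polynomials); for a tuple $x\in M^I$, $\mathrm{ev}_x$ is the unital $*$-homomorphism with $T_i\mapsto x_i$, and $P(x)=\mathrm{ev}_x(P)$. $C^*_X(x)$ is the $\|\cdot\|_{2;X}$-closure in $M$ of $\{P(x):P\in\mathbb{C}^*\langle(T_i)_{i\in I}\rangle\}$. For several tuples, $(a,b)$, $(a,b,c)$ denote concatenation, indexed by disjoint unions. For $R\in[0,\infty)^I$, $\Sigma_R$ is the set of linear functionals $\ell$ on $\mathbb{C}^*\langle(T_i)_{i\in I}\rangle$ with $\ell(1)=1$, $\ell(PQ)=\ell(QP)$,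 $\ell(P^*P)\ge0$, $\ell((T_i^*T_i)^k)\le R_i^{2k}$ for all $P,Q,i,k$, with the weak$^*$-topology (pointwise convergence on $*$-polynomials). $R$ is a cutoff function for $x\in M^I$ if $\|x_i\|\le R_i$ for all $i$; then $L_{x;X}=\{\tau\circ\mathrm{ev}_x:\tau\in X\}\subseteq\Sigma_R$. For $\mathcal O\subseteq\Sigma_R$, $\Gamma^{(k)}_R(\mathcal O)=\{A\in\prod_{i\in I}R_i\mathrm{Ball}(\mathbb{M}_k(\mathbb{C})):\ell_A\in\mathcal O\}$, where $\ell_A(P)=\mathrm{tr}(P(A))$ with $\mathrm{tr}$ the normalized trace; it carries the subspace topology from the product $\mathbb{M}_k(\mathbb{C})^I$. For finite $F\subseteq I$, $\|A\|_{2,F}=(\sum_{i\in F}\mathrm{tr}(A_i^*A_i))^{1/2}$. Let $I=I_1\sqcup I_2\sqcup I_3$ and $R\in[0,\infty)^I$ a cutoff function for $(a,b,c)$. For finite $F\subseteq I_1$, $G\subseteq I_2$, and $\varepsilon,\theta>0$, and $\Omega\subseteq\mathbb{M}_k(\mathbb{C})^{I}$, a map $f$ on $\Omega$ is $(\varepsilon,F|\theta,G)$-injective if for $x,y\in\Omega$ with $f(x)=f(y)$ and $\|x-y\|_{2,G}<\theta$ one has $\|x-y\|_{2,F}<\varepsilon$. $\dim_{\varepsilon,F|\theta,G}(\Omega)$ is the smallest $d$ such that there is a $d$-dimensional simplicial complex $\Delta$ and a continuous $(\varepsilon,F|\theta,G)$-injective map $\Omega\to\Delta$. For a weak$^*$-neighborhood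 $\mathcal O$ of $L_{a,b,c;X}$ in $\Sigma_R$ set $\mathrm{md}_{\varepsilon,F|\theta,G}(\mathcal O)=\limsup_{k\to\infty}k^{-2}\dim_{\varepsilon,F|\theta,G}(\Gamma^{(k)}_R(\mathcal O))$, $\mathrm{md}_{\varepsilon,F|\theta,G}(a|b:c)=\inf_{\mathcal O}\mathrm{md}_{\varepsilon,F|\theta,G}(\mathcal O)$, $\mathrm{md}_{\varepsilon,F}(a|b:c)=\inf_{\theta,G}\mathrm{md}_{\varepsilon,F|\theta,G}(a|b:c)$, and $\delta_{MD}(a|b:c)=\sup_{\varepsilon,F}\mathrm{md}_{\varepsilon,F}(a|b:c)$, over weak$^*$-neighborhoods $\mathcal O$ of $L_{a,b,c;X}$, $\theta>0$ and finite $G\subseteq I_2$, $\varepsilon>0$ and finite $F\subseteq I_1$. The cutoff functions used to define the two sides of the theorem's inequality are arbitrary (in particular $\delta_{MD}$ does not depend on the cutoff function). Analogous definitions apply to $a',b',c'$. *)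

(* Defs.v *)
From HB Require Import structures.
From mathcomp Require Import all_boot all_order all_algebra finmap.
From mathcomp Require Import all_classical all_reals all_analysis.
From mathcomp Require Import complex.
From mathcomp Require Import -(notations) monalg.
Import numFieldNormedType.Exports.

Set Implicit Arguments.
Unset Strict Implicit.
Unset Printing Implicit Defensive.

Import Order.TTheory GRing.Theory Num.Theory.
Local Open Scope classical_set_scope.
Local Open Scope ring_scope.

HB.mixin Record isStarAlgebra (C : numClosedFieldType) (A : Type)
    of GRing.Algebra C A := {
  star : A -> A;
  starD : forall x y : A, star (x + y) = star x + star y;
  starZ : forall (c : C) (x : A), star (c *: x) = c^* *: star x;
  starM : forall x y : A, star (x * y) = star y * star x;
  starK : involutive star
}.

#[short(type="starAlgType")]
HB.structure Definition StarAlgebra (C : numClosedFieldType) :=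
  {A of GRing.Algebra C A & isStarAlgebra C A}.

Section MatrixStar.
Variables (C : numClosedFieldType) (n : nat).

Definition mxstar (A : 'M[C]_n.+1) : 'M[C]_n.+1 := map_mx Num.conj (A^T).

Lemma mxstarD (A B : 'M[C]_n.+1) : mxstar (A + B) = mxstar A + mxstar B.
Proof. by rewrite /mxstar raddfD /= map_mxD. Qed.

Lemma mxstarZ (c : C) (A : 'M[C]_n.+1) : mxstar (c *: A) = c^* *: mxstar A.
Proof. by apply/matrixP => i j; rewrite !mxE rmorphM. Qed.

Lemma mxstarM (A B : 'M[C]_n.+1) : mxstar (A * B) = mxstar B * mxstar A.
Proof. by rewrite /mxstar trmx_mul map_mxM. Qed.

Lemma mxstarK : involutive mxstar.
Proof. by move=> A; apply/matrixP => i j; rewrite !mxE conjCK. Qed.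

HB.instance Definition _ :=
  isStarAlgebra.Build C 'M[C]_n.+1 mxstarD mxstarZ mxstarM mxstarK.

End MatrixStar.

Lemma malg_scalerAr (K : MonomialDef.type) (S : comNzRingType) (c : S)
    (P Q : malg K S) : c *: (P * Q) = P * (c *: Q).
Proof.
apply/malgP => w; rewrite mcoeffZ.
rewrite mcoeffMl (mcoeffMlw w (fsubset_refl (msupp P)) (msuppZ_le c Q)).
rewrite mulr_sumr; apply: eq_bigr => u _; rewrite mulr_sumr.
by apply: eq_bigr => v _; rewrite mcoeffZ mulrnAr mulrCA.
Qed.

(* The letter (i, false) stands for T_i and (i, true) for T_i^*, so that the
   monoid algebra of the free monoid on I * bool is the free unital *-algebra
   on I. *)
Section StarPolyTheory.
Variables (C : numClosedFieldType) (I : choiceType).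
Local Notation word := (fmonom (I * bool)%type).
Local Notation poly := (malg word C).

Definition star_word (w : word) : word :=
  FMonom (rev [seq (s.1, ~~ s.2) | s <- fmonom_val w]).

Definition starpoly_star (P : poly) : poly :=
  \sum_(w <- msupp P) mkmalgU (star_word w) (mcoeff w P)^*.

Lemma star_wordK : involutive star_word.
Proof.
case=> w; rewrite /star_word /= map_rev revK -map_comp; congr FMonom.
by rewrite -[RHS]map_id; apply: eq_map => -[i b] /=; rewrite negbK.
Qed.

Lemma star_wordM (u v : word) :
  star_word (mmul u v) = mmul (star_word v) (star_word u).
Proof.
by rewrite -![mmul _ _]/(fmmul _ _) !fmmulE /star_word /= map_cat rev_cat.
Qed.

Lemma mcoeff_star (P : poly) (w : word) :
  mcoeff w (starpoly_star P) = (mcoeff (star_word w) P)^*.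
Proof.
rewrite /starpoly_star raddf_sum /=.
rewrite (eq_bigr (fun u => (mcoeff u P)^* *+ (u == star_word w))); last first.
  by move=> u _; rewrite mcoeffU (can2_eq star_wordK star_wordK).
have [wP|wP] := boolP (star_word w \in msupp P).
  rewrite (big_fsetD1 _ wP) /= eqxx mulr1n big_seq big1 ?addr0 // => u.
  by rewrite in_fsetD1 => /andP[/negbTE-> _].
rewrite (mcoeff_outdom wP) rmorph0 big_seq big1 // => u uP.
by case: eqP uP wP => // -> ->.
Qed.

Lemma starpoly_starD (P Q : poly) :
  starpoly_star (P + Q) = starpoly_star P + starpoly_star Q.
Proof.
apply/malgP => w.
apply: etrans (esym (mcoeffD w (starpoly_star P) (starpoly_star Q))).
rewrite (mcoeff_star (P + Q)) (mcoeff_star P) (mcoeff_star Q).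
rewrite -rmorphD; congr (_^*).
exact: mcoeffD.
Qed.

Lemma starpoly_starZ (c : C) (P : poly) :
  starpoly_star (c *: P) = c^* *: starpoly_star P.
Proof.
apply/malgP => w.
apply: etrans (esym (mcoeffZ c^* (starpoly_star P) w)).
rewrite (mcoeff_star (c *: P)) (mcoeff_star P).
rewrite -rmorphM; congr (_^*).
exact: mcoeffZ.
Qed.

Lemma starpoly_starU (u : word) (c : C) :
  starpoly_star (mkmalgU u c) = mkmalgU (star_word u) c^*.
Proof.
apply/malgP => w; rewrite mcoeff_star !mcoeffU rmorphMn /=.
by rewrite (can2_eq star_wordK star_wordK).
Qed.

Lemma starpoly_starM (P Q : poly) :
  starpoly_star (P * Q) = starpoly_star Q * starpoly_star P.
Proof.
have star0 : starpoly_star 0 = 0.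
  by apply/malgP => w; rewrite mcoeff_star !mcoeff0 rmorph0.
rewrite [in LHS]malgME (big_morph _ starpoly_starD star0).
under eq_bigr do rewrite (big_morph _ starpoly_starD star0).
rewrite exchange_big /= [X in _ = X * _]/starpoly_star mulr_suml.
apply: eq_bigr => v _.
rewrite [X in _ = _ * X]/starpoly_star mulr_sumr; apply: eq_bigr => u _.
rewrite starpoly_starU star_wordM rmorphM mulrC.
by rewrite -[RHS]/(fgmul _ _) fgmulUU.
Qed.

Lemma starpoly_starK : involutive starpoly_star.
Proof.
by move=> P; apply/malgP => w; rewrite !mcoeff_star star_wordK conjCK.
Qed.

End StarPolyTheory.

Definition starpoly (C : numClosedFieldType) (I : choiceType) :=
  malg (fmonom (I * bool)%type) C.

Section StarPoly.
Variables (C : numClosedFieldType) (I : choiceType).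
Local Notation poly := (starpoly C I).

HB.instance Definition _ := GRing.Lalgebra.on poly.
HB.instance Definition _ :=
  GRing.Lalgebra_isAlgebra.Build C poly (@malg_scalerAr _ C).
HB.instance Definition _ := isStarAlgebra.Build C poly
  (@starpoly_starD C I) (@starpoly_starZ C I) (@starpoly_starM C I)
  (@starpoly_starK C I).

Definition starpolyX (i : I) : poly := mkmalgU (FMonom [:: (i, false)]) 1.

Definition ev (A : starAlgType C) (x : I -> A) (P : poly) : A :=
  \sum_(w <- msupp P)
    mcoeff w P *: \prod_(s <- fmonom_val w) (if s.2 then star (x s.1) else x s.1).

End StarPoly.

Local Open Scope complex_scope.

Section Norms.
Variables (R : realType) (V : lmodType R[i]).

Definition is_norm (p : V -> R) : Prop :=
  [/\ forall x y, p (x + y) <= p x + p y,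
      forall (c : R[i]) x, p (c *: x) = complex.Re `|c| * p x
    & forall x, p x = 0 -> x = 0].

(* B is complete for the metric p (x - y), when p is a norm. *)
Definition complete_for (p : V -> R) (B : set V) : Prop :=
  forall u : nat -> V,
    (forall n, B (u n)) ->
    (forall e : R, 0 < e ->
       exists N, forall m n, (N <= m)%N -> (N <= n)%N -> p (u m - u n) < e) ->
    exists2 x, B x & p (u n - x) @[n --> \oo] --> (0 : R).

End Norms.

(* The C*-norm is a separate field because the library admits no common
   extension of its ring and normed structures other than numDomainType. *)
HB.mixin Record StarAlgebra_isCStarAlgebra (R : realType) (A : Type)
    of StarAlgebra R[i] A := {
  cnorm : A -> R;
  cnorm_is_norm : is_norm (cnorm : A -> R);
  cnorm_complete : complete_for (cnorm : A -> R) [set: A];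
  cnormM : forall x y : A, cnorm (x * y) <= cnorm x * cnorm y;
  cnorm_star : forall x : A, cnorm (star x * x) = cnorm x ^+ 2
}.

#[short(type="cstarAlgType")]
HB.structure Definition CStarAlgebra (R : realType) :=
  {A of StarAlgebra R[i] A & StarAlgebra_isCStarAlgebra R A}.

Section TraciallyComplete.
Variables (R : realType) (M : cstarAlgType R).

(* A positive functional on a unital C*-algebra with value 1 at 1 is a state. *)
Definition tracial_state (tau : M -> R[i]) : Prop :=
  [/\ scalar tau, tau 1 = 1, forall x, 0 <= tau (star x * x)
    & forall x y, tau (x * y) = tau (y * x)].

Definition norm2X (X : set (M -> R[i])) (x : M) : R :=
  sup [set Num.sqrt (complex.Re (tau (star x * x))) | tau in X].

(* The supremum of the empty set is 0, so X is nonempty as norm2X X is a norm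
   and 1 != 0 in M. *)
Record tracially_complete (X : set (M -> R[i])) : Prop := {
  tc_tracial : X `<=` tracial_state;
  tc_compact : compact (X : set {ptws M -> R[i]^o});
  tc_convex : forall sigma tau (t : R), X sigma -> X tau -> 0 <= t <= 1 ->
    X (fun x => t%:C * sigma x + (1 - t)%:C * tau x);
  tc_norm : is_norm (norm2X X);
  tc_complete : complete_for (norm2X X) [set x | cnorm x <= 1]
}.

Definition cstarX (X : set (M -> R[i])) (I : choiceType) (x : I -> M) : set M :=
  [set y | forall e : R, 0 < e ->
     exists P : starpoly R[i] I, norm2X X (y - ev x P) < e].

Definition cutoff (I : choiceType) (r : I -> R) (x : I -> M) : Prop :=
  (forall i, 0 <= r i) /\ (forall i, cnorm (x i) <= r i).

End TraciallyComplete.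

Definition concat (I J T : Type) (x : I -> T) (y : J -> T) (s : I + J) : T :=
  match s with inl i => x i | inr j => y j end.

Section Laws.
Variables (R : realType) (I : choiceType).
Local Notation functional := (starpoly R[i] I -> R[i]).

Definition Sigma_ (r : I -> R) : set functional :=
  [set l | [/\ scalar l, l 1 = 1, forall P Q, l (P * Q) = l (Q * P),
      forall P, 0 <= l (star P * P)
    & forall i k, l ((star (starpolyX _ i) * starpolyX _ i) ^+ k)
                    <= (r i ^+ (2 * k))%:C]].

Definition laws (M : cstarAlgType R) (X : set (M -> R[i])) (x : I -> M) :
  set functional := [set tau \o ev x | tau in X].

Definition weak_nbhd (r : I -> R) (L O : set functional) : Prop :=
  O `<=` Sigma_ r /\
  exists W : set functional,
    [/\ open (W : set {ptws starpoly R[i] I -> R[i]^o}),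
        L `<=` W & W `&` Sigma_ r `<=` O].

End Laws.

(* The dimension k >= 1 of matrices is written n.+1. *)
Section Microstates.
Variables (R : realType) (n : nat).
Local Notation mat := 'M[R[i]]_n.+1.

Definition ntr (A : mat) : R[i] := \tr A / n.+1%:R.

Definition l2norm (v : 'cV[R[i]]_n.+1) : R :=
  Num.sqrt (\sum_i complex.Re `|v i ord0| ^+ 2).

Definition opnorm (A : mat) : R :=
  sup [set l2norm (A *m v) | v in [set v | l2norm v <= 1]].

Definition norm2F (J : choiceType) (F : {fset J}) (A : J -> mat) : R :=
  Num.sqrt (complex.Re (\sum_(i <- F) ntr (star (A i) * A i))).

Definition law_mx (I : choiceType) (A : I -> mat) : starpoly R[i] I -> R[i] :=
  fun P => ntr (ev A P).

Definition microstates (I : choiceType) (r : I -> R)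
    (O : set (starpoly R[i] I -> R[i])) : set (I -> mat) :=
  [set A | (forall i, opnorm (A i) <= r i) /\ O (law_mx A)].

End Microstates.

Record simplicial_complex (V : choiceType) := SimplicialComplex {
  faces : set {fset V};
  faces_neq0 : forall s, faces s -> s != fset0;
  faces_sub : forall s t, faces s -> (t `<=` s)%fset -> t != fset0 -> faces t
}.

Definition has_dim (V : choiceType) (K : simplicial_complex V) (d : nat) : Prop :=
  (forall s, faces K s -> (#|` s| <= d.+1)%N) /\
  (exists2 s, faces K s & #|` s| = d.+1).

(* The closed simplex spanned by s, in barycentric coordinates. *)
Definition simplex (R : realType) (V : choiceType) (s : {fset V}) : set (V -> R) :=
  [set p | [/\ forall v, 0 <= p v, forall v, v \notin s -> p v = 0
             & \sum_(v <- s) p v = 1]].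

Section Realization.
Variables (R : realType) (V : choiceType) (K : simplicial_complex V).

Record realization := Realization {
  bary : V -> R;
  baryP : exists2 s, faces K s & simplex s bary
}.

HB.instance Definition _ := gen_eqMixin realization.
HB.instance Definition _ := gen_choiceMixin realization.

(* Coherent topology: U is open iff its trace on each closed simplex is
   relatively open. On a closed simplex, which involves finitely many
   coordinates, pointwise convergence gives the Euclidean topology. *)
Definition coherent_open (U : set realization) : Prop :=
  forall s, faces K s -> exists2 W : set (V -> R),
    open (W : set {ptws V -> R}) &
    forall p, simplex s (bary p) -> (U p <-> W (bary p)).

Lemma coherent_openT : coherent_open setT.
Proof. by move=> s _; exists setT => //; exact: openT. Qed.

Lemma coherent_openI : setI_closed coherent_open.
Proof.
move=> A B oA oB s sK.
have [W oW AW] := oA s sK; have [W' oW' BW'] := oB s sK.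
exists (W `&` W'); first exact: (@openI {ptws V -> R}).
by move=> p ps; split=> -[/(AW p ps) ? /(BW' p ps) ?].
Qed.

Lemma coherent_open_bigU (J : Type) (A : J -> set realization) :
  (forall j, coherent_open (A j)) -> coherent_open (\bigcup_j A j).
Proof.
move=> oA s sK.
have /choice[W HW] j : exists W : set (V -> R),
    open (W : set {ptws V -> R}) /\
    forall p, simplex s (bary p) -> (A j p <-> W (bary p)).
  by have [W] := oA j s sK; exists W.
exists (\bigcup_j W j).
  by apply: (@bigcup_open {ptws V -> R}) => j _; exact: (HW j).1.
by move=> p ps; split=> -[j _ /((HW j).2 p ps) ?]; exists j.
Qed.

HB.instance Definition _ := isOpenTopological.Build realization
  coherent_openT coherent_openI coherent_open_bigU.

End Realization.

Section Dimension.
Variables (R : realType) (n : nat) (I1 I2 I3 : choiceType).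
Local Notation I := (I1 + I2 + I3)%type.
Local Notation mat := 'M[R[i]]_n.+1.
Local Notation tuples := {ptws I -> 'M[R[i]^o]_n.+1}.

Definition approx_injective (eps : R) (F : {fset I1}) (theta : R)
    (G : {fset I2}) (Omega : set (I -> mat)) (T : Type) (f : (I -> mat) -> T) :=
  forall x y, Omega x -> Omega y -> f x = f y ->
    norm2F G (fun j => x (inl (inr j)) - y (inl (inr j))) < theta ->
    norm2F F (fun i => x (inl (inl i)) - y (inl (inl i))) < eps.

(* An infimum of natural numbers is attained, except that it is +oo when no
   such complex exists. A map on Omega is extended arbitrarily to all tuples:
   the realization of a d-dimensional complex is nonempty. *)
Definition dim_approx (eps : R) (F : {fset I1}) (theta : R) (G : {fset I2})
    (Omega : set (I -> mat)) : \bar R :=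
  ereal_inf [set (d%:R)%:E | d in [set d : nat |
    exists (V : choiceType) (K : simplicial_complex V)
      (f : tuples -> realization R K),
      [/\ has_dim K d, {within (Omega : set tuples), continuous f}
        & approx_injective eps F theta G Omega f]]].

End Dimension.

Section MeanDimension.
Variables (R : realType) (M : cstarAlgType R) (X : set (M -> R[i])).
Variables (I1 I2 I3 : choiceType).
Local Notation I := (I1 + I2 + I3)%type.
Variable (r : I -> R).

(* The term of index n is the one of matrix size k = n.+1. *)
Definition md_nbhd (eps : R) (F : {fset I1}) (theta : R) (G : {fset I2})
    (O : set (starpoly R[i] I -> R[i])) : \bar R :=
  limn_esup (fun n : nat => (((n.+1%:R : R) ^- 2)%:E *
    dim_approx eps F theta G (microstates (n := n) r O))%E).

Variables (a : I1 -> M) (b : I2 -> M) (c : I3 -> M).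

Definition md_theta (eps : R) (F : {fset I1}) (theta : R) (G : {fset I2}) :
    \bar R :=
  ereal_inf [set md_nbhd eps F theta G O | O in
    [set O | weak_nbhd r (laws X (concat (concat a b) c)) O]].

Definition md_eps (eps : R) (F : {fset I1}) : \bar R :=
  ereal_inf [set md_theta eps F q.1 q.2 | q in
    [set q : R * {fset I2} | 0 < q.1]].

Definition delta_MD : \bar R :=
  ereal_sup [set md_eps q.1 q.2 | q in [set q : R * {fset I1} | 0 < q.1]].

End MeanDimension.

(* Main.v *)
From HB Require Import structures.
Require Import Defs.
From mathcomp Require Import all_boot all_order all_algebra finmap.
From mathcomp Require Import all_classical all_reals all_analysis complex.
From mathcomp Require Import -(notations) monalg.
From mathcomp Require Import ring lra.
Import numFieldNormedType.Exports.

Set Implicit Arguments.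
Unset Strict Implicit.
Unset Printing Implicit Defensive.

Import Order.TTheory GRing.Theory Num.Theory.
Local Open Scope classical_set_scope.
Local Open Scope ring_scope.
Local Open Scope complex_scope.

(* Approximate the tuples a', b', c' in the trace norm by values of *-polynomials
   T at (a, b, c), those for b' involving only b. By the Kaplansky density theorem
   T can be chosen to respect the cutoff functions, also on matrices. Then
   A |-> T(A) maps microstates for (a, b, c) to microstates for (a', b', c'), and
   since a is nearly a *-polynomial Q in (a', b'), it turns approximately injective
   maps for the latter into approximately injective maps for the former.

   The density theorem is proved by *-polynomials alone, uniformly over all
   positive functionals on all *-algebras: a contraction m is approximated by
   2y(1 + y^*y)^-1 with y a *-polynomial, and the inverse is replaced by a partial
   sum of a geometric series. *)

(** * Evaluation of *-polynomials *)

(** A polynomial approximant in the trace norm has no controlled operator norm, while a microstate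
    must obey its cutoff exactly and in every matrix size. No universal C*-algebra with the given
    cutoffs is constructed; instead [lbound] measures left multiplication in the seminorm of a
    positive functional. Taken over all vector functionals it is the operator norm of a matrix, for
    the normalized trace it gives the 2-norm estimates, and for the states in [X] the estimates in
    [M], so a single inequality serves all three. The function 2s/(1 + s^2) sends the real line into
    [-1, 1], hence any polynomial, however large, to a contraction; it also sends [-1, 1] onto
    itself, so no contraction is lost. The letters of [b'] have to come from [b] alone because
    approximate injectivity presupposes closeness in the second block only. The polynomials [Q] may
    involve [b']; those letters are controlled through [theta] and [G], not through the map into the
    complex. *)

Section StarAlgebraTheory.
Variables (C : numClosedFieldType) (A : starAlgType C).
Implicit Types x y : A.

Lemma star_is_zmod_morphism : zmod_morphism (star : A -> A).
Proof.
move=> x y; rewrite starD; congr (_ + _).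
by rewrite -scaleN1r starZ rmorphN1 scaleN1r.
Qed.

HB.instance Definition _ :=
  GRing.isZmodMorphism.Build A A star star_is_zmod_morphism.

Lemma star0 : star (0 : A) = 0. Proof. exact: raddf0. Qed.
Lemma starB x y : star (x - y) = star x - star y. Proof. exact: raddfB. Qed.

Lemma star1 : star (1 : A) = 1.
Proof. by have := starM (star (1 : A)) 1; rewrite !mulr1 !starK mulr1. Qed.

Lemma starX x n : star (x ^+ n) = star x ^+ n.
Proof. by elim: n => [|n IH]; rewrite ?star1 // exprS starM IH -exprSr. Qed.

End StarAlgebraTheory.

Section Evaluation.
Variables (C : numClosedFieldType) (I : choiceType) (A : starAlgType C).
Variable x : I -> A.
Local Notation word := (fmonom (I * bool)%type).
Local Notation poly := (starpoly C I).

Definition ev_letter (s : I * bool) : A := if s.2 then star (x s.1) else x s.1.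
Definition ev_word (w : word) : A := \prod_(s <- fmonom_val w) ev_letter s.

(** Freeing the sum from the exact support lets several polynomials be compared over one index
    set. *)
Lemma evEw (d : {fset word}) (P : poly) : (msupp P `<=` d)%fset ->
  ev x P = \sum_(w <- d) mcoeff w P *: ev_word w.
Proof.
move=> sPd; apply: (big_fset_incl _ sPd) => w _ wP.
by rewrite (mcoeff_outdom wP) scale0r.
Qed.

Lemma ev_is_linear : linear (ev x : poly -> A).
Proof.
move=> c P Q; pose d := (msupp P `|` msupp Q)%fset.
have sd : (msupp (c *: P + Q)%R `<=` d)%fset.
  apply: fsubset_trans (msuppD_le _ _) _.
  by apply: fsetSU; exact: msuppZ_le.
rewrite (evEw sd) (@evEw d P) ?fsubsetUl// (@evEw d Q) ?fsubsetUr//.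
rewrite scaler_sumr -big_split /=; apply: eq_bigr => w _.
by rewrite scalerA -scalerDl; congr (_ *: _); rewrite -mcoeffZ -mcoeffD.
Qed.

HB.instance Definition _ :=
  GRing.isLinear.Build C poly A *:%R (ev x) ev_is_linear.

Lemma ev_mkmalgU (w : word) (c : C) :
  ev x (mkmalgU w c : poly) = c *: ev_word w.
Proof.
rewrite (@evEw [fset w]%fset); last exact: msuppU_le.
by rewrite big_seq_fset1 mcoeffUU.
Qed.

Lemma ev_wordM (u v : word) : ev_word (mmul u v) = ev_word u * ev_word v.
Proof. by rewrite -[mmul _ _]/(fmmul _ _) fmmulE /ev_word big_cat. Qed.

Lemma ev_word_star (w : word) : ev_word (star_word w) = star (ev_word w).
Proof.
case: w => w; rewrite /ev_word /star_word /=.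
elim: w => [|[i b] w IH]; first by rewrite !big_nil star1.
rewrite /= rev_cons -cats1 big_cat big_seq1 IH big_cons starM; congr (_ * _).
by rewrite /ev_letter /=; case: b => //=; rewrite starK.
Qed.

Lemma ev_is_monoid_morphism : monoid_morphism (ev x : poly -> A).
Proof.
split=> [|P Q].
  apply: etrans (ev_mkmalgU mone 1) _.
  by rewrite scale1r /ev_word -[mone]/(fmone _) fmoneE big_nil.
rewrite [in LHS]malgME raddf_sum /=.
rewrite [X in _ = X * _]/ev mulr_suml; apply: eq_bigr => u _.
rewrite raddf_sum /= [X in _ = _ * X]/ev mulr_sumr; apply: eq_bigr => v _.
rewrite [X in X = _](ev_mkmalgU (mmul u v) (mcoeff u P * mcoeff v Q)).
by rewrite ev_wordM -scalerAr -!scalerAl scalerA mulrC.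
Qed.

HB.instance Definition _ :=
  GRing.isMonoidMorphism.Build poly A (ev x) ev_is_monoid_morphism.

Lemma ev1 : ev x (1 : poly) = 1.
Proof. exact: rmorph1. Qed.

Lemma evD (P Q : poly) : ev x (P + Q) = ev x P + ev x Q.
Proof. exact: raddfD. Qed.

Lemma evB (P Q : poly) : ev x (P - Q) = ev x P - ev x Q.
Proof. exact: raddfB. Qed.

Lemma evM (P Q : poly) : ev x (P * Q) = ev x P * ev x Q.
Proof. exact: rmorphM. Qed.

Lemma evX (P : poly) n : ev x (P ^+ n) = ev x P ^+ n.
Proof. exact: rmorphXn. Qed.

Lemma evZ c (P : poly) : ev x (c *: P) = c *: ev x P.
Proof. exact: linearZ. Qed.

Lemma ev_star (P : poly) : ev x (star P) = star (ev x P).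
Proof.
rewrite [star P]/(starpoly_star P) /starpoly_star raddf_sum /=.
rewrite [in RHS]/ev raddf_sum /=.
by apply: eq_bigr => w _; rewrite ev_mkmalgU ev_word_star starZ.
Qed.

Lemma ev_starpolyX i : ev x (starpolyX C i) = x i.
Proof. by rewrite ev_mkmalgU scale1r /ev_word /= big_seq1. Qed.

End Evaluation.

(** [starpoly C I] is itself a *-algebra, so [ev T P] is substitution of the polynomials [T] into
    [P]. *)
Lemma ev_comp (C : numClosedFieldType) (I J : choiceType) (A : starAlgType C)
    (x : I -> A) (T : J -> starpoly C I) (P : starpoly C J) :
  ev x (ev T P) = ev (fun j => ev x (T j)) P.
Proof.
rewrite [ev T P]/ev raddf_sum; apply: eq_bigr => w _ /=.
rewrite linearZ rmorph_prod; congr (_ *: _); apply: eq_bigr => -[j []] _ //=.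
exact: ev_star.
Qed.

(** * Positive functionals and their seminorms *)

Lemma ReM_real (R : realType) (t : R) (z : R[i]) :
  complex.Re (t%:C * z) = t * complex.Re z.
Proof. by case: z => a b /=; rewrite mul0r subr0. Qed.

Lemma Re_norm_ge0 (R : realType) (z : R[i]) : 0 <= complex.Re `|z|.
Proof. by case: z => a b /=; exact: sqrtr_ge0. Qed.

Section PositiveFunctionals.
Variables (R : realType) (A : starAlgType R[i]).

(** No normalization is imposed, so that the functionals of arbitrary vectors, the zero vector
    included, are covered. *)
Definition positive_functional (phi : A -> R[i]) : Prop :=
  scalar phi /\ forall x, 0 <= phi (star x * x).

Definition pform (phi : A -> R[i]) (x y : A) : R :=
  complex.Re (phi (star x * y)).

Definition pnorm (phi : A -> R[i]) (x : A) : R := Num.sqrt (pform phi x x).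

Definition tracial (phi : A -> R[i]) : Prop :=
  forall x y, phi (x * y) = phi (y * x).

(** Left multiplication by [y] has norm at most [N] on the GNS space of [phi]; this replaces the
    operator norm in *-algebras that carry none. *)
Definition lbound (phi : A -> R[i]) (y : A) (N : R) : Prop :=
  0 <= N /\ forall w, pnorm phi (y * w) <= N * pnorm phi w.

Variable phi : A -> R[i].
Hypothesis phi_pos : positive_functional phi.

Let phiD x y : phi (x + y) = phi x + phi y.
Proof. by have := phi_pos.1 1 x y; rewrite scale1r mul1r. Qed.

Let phi0 : phi 0 = 0.
Proof. by apply: (addrI (phi 0)); rewrite -phiD !addr0. Qed.

Let phiZ c x : phi (c *: x) = c * phi x.
Proof. by have := phi_pos.1 c x 0; rewrite phi0 !addr0. Qed.

Lemma positive_functionalB x y : phi (x - y) = phi x - phi y.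
Proof. by rewrite phiD -scaleN1r phiZ mulN1r. Qed.

Lemma pformDl x y z : pform phi (x + y) z = pform phi x z + pform phi y z.
Proof. by rewrite /pform starD mulrDl phiD raddfD. Qed.

Lemma pformDr x y z : pform phi z (x + y) = pform phi z x + pform phi z y.
Proof. by rewrite /pform mulrDr phiD raddfD. Qed.

Lemma pformZr (t : R) x y : pform phi x (t%:C *: y) = t * pform phi x y.
Proof. by rewrite /pform -scalerAr phiZ ReM_real. Qed.

(** Positivity makes [phi] hermitian: since [phi] is real at [star (1 + y) * (1 + y)], the imaginary
    parts at [y] and [star y] cancel, and y = ix turns this into equality of real parts. *)
Lemma Re_phi_star x : complex.Re (phi (star x)) = complex.Re (phi x).
Proof.
have Im0 y : complex.Im (phi (star y * y)) = 0 by apply: ger0_Im; apply: phi_pos.2.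
have Im1 : complex.Im (phi 1) = 0 by have := Im0 1; rewrite star1 mul1r.
have ImD y : complex.Im (phi y) + complex.Im (phi (star y)) = 0.
  have := Im0 (1 + y); rewrite starD star1 mulrDl mul1r mulrDr mulr1 !phiD.
  by rewrite !(raddfD (@complex.Im R)) /= Im0 Im1 add0r addr0.
have := ImD ('i *: x); rewrite starZ !phiZ [('i)^*%R]/('i^*).
by case: (phi x) (phi (star x)) => [u v] [u' v'] /=; lra.
Qed.

Lemma pformC x y : pform phi x y = pform phi y x.
Proof. by rewrite /pform -Re_phi_star starM starK. Qed.

Lemma pformZl (t : R) x y : pform phi (t%:C *: x) y = t * pform phi x y.
Proof. by rewrite pformC pformZr pformC. Qed.

Lemma pform_ge0 x : 0 <= pform phi x x.
Proof. by have := phi_pos.2 x; rewrite lecE => /andP[]. Qed.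

Lemma pform_mulr x y z : pform phi x (y * z) = pform phi (star y * x) z.
Proof. by rewrite /pform starM starK mulrA. Qed.

Lemma pnorm_ge0 x : 0 <= pnorm phi x.
Proof. exact: sqrtr_ge0. Qed.

Lemma pnorm_sqr x : pnorm phi x ^+ 2 = pform phi x x.
Proof. by rewrite sqr_sqrtr // pform_ge0. Qed.

Lemma positive_functional_sqr x : phi (star x * x) = (pnorm phi x ^+ 2)%:C.
Proof. by rewrite pnorm_sqr RRe_real // ger0_real // phi_pos.2. Qed.

Lemma pform_CauchySchwarz x y : pform phi x y <= pnorm phi x * pnorm phi y.
Proof.
have [p0|p0] := leP (pform phi x y) 0.
  by rewrite (le_trans p0) // mulr_ge0 ?pnorm_ge0.
have H s : 0 <= pform phi x x + s * pform phi x y *+ 2 + s ^+ 2 * pform phi y y.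
  have := pform_ge0 (x + s%:C *: y).
  rewrite pformDl !pformDr !pformZl !pformZr (pformC y x); lra.
rewrite -(ler_pXn2r (n := 2)) ?nnegrE ?mulr_ge0 ?pnorm_ge0 //; last exact: ltW.
rewrite exprMn !pnorm_sqr.
(* At this value of s the quadratic equals a(ab - p^2)/p^2, which settles the case a > 0. *)
have := H (- pform phi x x / pform phi x y).
set p := pform phi x y; set a := pform phi x x; set b := pform phi y y.
rewrite -/p in p0.
have -> : a + - a / p * p *+ 2 + (- a / p) ^+ 2 * b = a * (a * b - p ^+ 2) / p ^+ 2.
  by field; rewrite gt_eqF.
have a0 : 0 <= a by exact: pform_ge0.
rewrite pmulr_lge0 ?invr_gt0 ?exprn_gt0 //.
move: a0; rewrite le_eqVlt => /orP[/eqP a0 _|a0]; last first.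
  by rewrite pmulr_rge0 // subr_ge0.
have b0 : 0 <= b by exact: pform_ge0.
(* For a = 0 the previous choice says nothing; this one makes the quadratic negative, a
   contradiction. The denominator b + 1 stays positive when b = 0. *)
have := H (- p / (b + 1)); rewrite -/a -/b -/p -a0.
have b1 : b + 1 != 0 by rewrite gt_eqF // ltr_wpDl.
have -> : 0 + - p / (b + 1) * p *+ 2 + (- p / (b + 1)) ^+ 2 * b
   = - (p ^+ 2 * (b + 2) / (b + 1) ^+ 2) by field.
rewrite oppr_ge0 => /le_gtF; rewrite divr_gt0 ?mulr_gt0 ?exprn_gt0 //; lra.
Qed.

Lemma pnormD x y : pnorm phi (x + y) <= pnorm phi x + pnorm phi y.
Proof.
rewrite -(ler_pXn2r (n := 2)) ?nnegrE ?addr_ge0 ?pnorm_ge0 //.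
rewrite pnorm_sqr pformDl !pformDr (pformC y x) sqrrD !pnorm_sqr.
have := pform_CauchySchwarz x y; lra.
Qed.

Lemma pnormZ c x : pnorm phi (c *: x) = complex.Re `|c| * pnorm phi x.
Proof.
rewrite /pnorm /pform starZ -scalerAl -scalerAr scalerA phiZ.
have -> : c^* * c = (complex.Re `|c| ^+ 2)%:C.
  by case: c => a b; simpc; rewrite /= sqr_sqrtr ?addr_ge0 ?sqr_ge0 //; congr (_ +i* _); ring.
by rewrite ReM_real sqrtrM ?sqr_ge0 // sqrtr_sqr ger0_norm ?Re_norm_ge0.
Qed.

Lemma pnormN x : pnorm phi (- x) = pnorm phi x.
Proof. by rewrite -scaleN1r pnormZ normrN1 mul1r. Qed.

Lemma pnormB x y : pnorm phi (x - y) <= pnorm phi x + pnorm phi y.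
Proof. by rewrite -(pnormN y) pnormD. Qed.

Lemma pnorm0 : pnorm phi 0 = 0.
Proof. by rewrite /pnorm /pform mulr0 phi0 sqrtr0. Qed.

Lemma pnormZ_real (t : R) x : 0 <= t -> pnorm phi (t%:C *: x) = t * pnorm phi x.
Proof. by move=> t0; rewrite pnormZ ger0_norm ?ler0c. Qed.

Lemma lbound_le y N N' : N <= N' -> lbound phi y N -> lbound phi y N'.
Proof.
move=> NN [N0 H]; split=> [|w]; first exact: le_trans NN.
by apply: le_trans (H w) _; rewrite ler_wpM2r ?pnorm_ge0.
Qed.

Lemma lbound1 : lbound phi 1 1.
Proof. by split=> // w; rewrite !mul1r. Qed.

Lemma lbound0 : lbound phi 0 0.
Proof. by split=> // w; rewrite !mul0r pnorm0. Qed.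

Lemma lboundD x y N N' : lbound phi x N -> lbound phi y N' ->
  lbound phi (x + y) (N + N').
Proof.
move=> [N0 H] [N0' H']; split=> [|w]; first exact: addr_ge0.
by rewrite !mulrDl; apply: le_trans (pnormD _ _) _; apply: lerD.
Qed.

Lemma lboundM x y N N' : lbound phi x N -> lbound phi y N' ->
  lbound phi (x * y) (N * N').
Proof.
move=> [N0 H] [N0' H']; split=> [|w]; first exact: mulr_ge0.
by rewrite -!mulrA; apply: le_trans (H _) _; rewrite ler_wpM2l.
Qed.

Lemma lboundZ c x N : lbound phi x N -> lbound phi (c *: x) (complex.Re `|c| * N).
Proof.
move=> [N0 H]; split=> [|w]; first by rewrite mulr_ge0 ?Re_norm_ge0.
by rewrite -scalerAl pnormZ -mulrA ler_wpM2l ?Re_norm_ge0.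
Qed.

Lemma lboundX x N n : lbound phi x N -> lbound phi (x ^+ n) (N ^+ n).
Proof.
by move=> H; elim: n => [|n IH]; [exact: lbound1 | rewrite !exprS; exact: lboundM].
Qed.

(** The square of the seminorm of [star y * w] is the pairing of [w] with [y * (star y * w)];
    Cauchy-Schwarz bounds it by N times the seminorms of [w] and of [star y * w], and one factor
    cancels. *)
Lemma lbound_star y N : lbound phi y N -> lbound phi (star y) N.
Proof.
move=> [N0 H]; split=> // w.
have [->|y0] := eqVneq (pnorm phi (star y * w)) 0; first by rewrite mulr_ge0 ?pnorm_ge0.
have y1 : 0 < pnorm phi (star y * w) by rewrite lt_def y0 pnorm_ge0.
rewrite -(ler_pM2r y1) -expr2 pnorm_sqr -pform_mulr.
apply: le_trans (pform_CauchySchwarz _ _) _.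
by rewrite (mulrC N) -mulrA ler_wpM2l ?pnorm_ge0.
Qed.

Hypothesis phi_tr : tracial phi.

Lemma pnorm_star x : pnorm phi (star x) = pnorm phi x.
Proof. by rewrite /pnorm /pform starK phi_tr. Qed.

Lemma pnormMr y N z : lbound phi y N -> pnorm phi (z * y) <= N * pnorm phi z.
Proof. by move=> /lbound_star[_ H]; rewrite -pnorm_star starM -(pnorm_star z). Qed.

End PositiveFunctionals.

(** * Polynomial truncation *)

Section Truncation.
Variable R : realType.

(** With q = 1 - c(1 + t), the inverse of 1 + t is c times the Neumann series in q; [trunc_h] is its
    partial sum. *)
Definition trunc_q (A : starAlgType R[i]) (c : R) (t : A) : A :=
  1 - c%:C *: (1 + t).

Definition trunc_h (A : starAlgType R[i]) (c : R) (J : nat) (t : A) : A :=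
  c%:C *: \sum_(j < J) trunc_q c t ^+ j.

(* As [J] grows this approaches 2y(1 + y^*y)^-1, which has norm at most 1. *)
Definition trunc (A : starAlgType R[i]) (c : R) (J : nat) (y : A) : A :=
  (y * trunc_h c J (star y * y)) *+ 2.

Lemma ev_trunc (I : choiceType) (A : starAlgType R[i]) (x : I -> A) c J
    (P : starpoly R[i] I) : ev x (trunc c J P) = trunc c J (ev x P).
Proof.
rewrite /trunc mulr2n evD -mulr2n evM /trunc_h evZ (raddf_sum (ev x)) /=.
congr ((_ * (_ *: _)) *+ 2); apply: eq_bigr => j _.
by rewrite evX /trunc_q evB evZ evD evM ev1 ev_star.
Qed.

Section Identities.
Variables (A : starAlgType R[i]) (c : R) (J : nat).
Implicit Types t y : A.

Lemma trunc_hE t : (1 + t) * trunc_h c J t = 1 - trunc_q c t ^+ J.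
Proof.
rewrite /trunc_h -scalerAr scalerAl.
have -> : c%:C *: (1 + t) = 1 - trunc_q c t by rewrite /trunc_q subKr.
by rewrite -opprB mulNr -subrX1 opprB.
Qed.

Lemma trunc_hC t : (1 + t) * trunc_h c J t = trunc_h c J t * (1 + t).
Proof.
rewrite /trunc_h -scalerAr -scalerAl mulr_sumr mulr_suml; congr (_ *: _).
apply: eq_bigr => j _; apply: commrX; apply: commrB; first exact: commr1.
by rewrite /GRing.comm -scalerAr -scalerAl.
Qed.

Lemma trunc_h_star y : trunc_h c J (y * star y) * y = y * trunc_h c J (star y * y).
Proof.
rewrite /trunc_h -scalerAr -scalerAl mulr_sumr mulr_suml; congr (_ *: _).
apply: eq_bigr => j _.
have qy : trunc_q c (y * star y) * y = y * trunc_q c (star y * y).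
  rewrite /trunc_q mulrBl mulrBr mul1r mulr1 -scalerAl -scalerAr.
  by rewrite mulrDl mulrDr mul1r mulr1 mulrA.
elim: (j : nat) => [|k IH]; first by rewrite mul1r mulr1.
by rewrite exprS -mulrA IH mulrA qy -mulrA -exprS.
Qed.

End Identities.

Variables (A : starAlgType R[i]) (phi : A -> R[i]).
Hypothesis phi_pos : positive_functional phi.

Let psq_le (u v : A) (N : R) : 0 <= N ->
  pform phi u u <= N ^+ 2 * pform phi v v -> pnorm phi u <= N * pnorm phi v.
Proof.
move=> N0 H; rewrite -(ler_pXn2r (n := 2)) ?nnegrE ?mulr_ge0 ?pnorm_ge0 //.
by rewrite exprMn !pnorm_sqr.
Qed.

Let pformBl x y z : pform phi (x - y) z = pform phi x z - pform phi y z.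
Proof.
by rewrite pformDl // -scaleN1r -(rmorphN1 (real_complex R)) pformZl // mulN1r.
Qed.

Let pformBr x y z : pform phi z (x - y) = pform phi z x - pform phi z y.
Proof. by rewrite !(pformC phi_pos z) pformBl. Qed.

Variables (y : A) (N : R).
Hypotheses (N1 : 1 <= N) (yN : lbound phi y N).

(** If t = y^*y lies between 0 and N^2, this scaling places q = 1 - c(1 + t) between 0 and 1 - c. *)
Definition trunc_c : R := (1 + N ^+ 2)^-1.
Local Notation c := trunc_c.
Local Notation t := (star y * y).

Let N0 : 0 < N. Proof. exact: lt_le_trans N1. Qed.
Let N20 : 0 < 1 + N ^+ 2. Proof. by rewrite ltr_pwDl // sqr_ge0. Qed.

Lemma trunc_c_itv : 0 < trunc_c < 1.
Proof. by rewrite invr_gt0 N20 invf_lt1 // ltrDl exprn_gt0. Qed.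

Let pform_t u v : pform phi u (t * v) = pform phi (y * u) (y * v).
Proof. by rewrite -mulrA pform_mulr // starK. Qed.

(** Here q = (1 - c)(1 - N^-2 t), and the second factor is a contraction: expanding its squared
    seminorm, the term in |tw|^2 is absorbed because |tw|^2 <= N^2 <w, tw>. *)
Lemma lbound_trunc_q : lbound phi (trunc_q c t) (1 - c).
Proof.
have /andP[c0 c1] := trunc_c_itv.
have qE : trunc_q c t = (1 - c)%:C *: (1 - (N ^- 2)%:C *: t).
  rewrite /trunc_q scalerBr scalerA -rmorphM.
  have -> : (1 - c) * N ^- 2 = c by rewrite /trunc_c; field; rewrite !gt_eqF // -expr2.
  by rewrite rmorphB rmorph1 scalerBl scale1r scalerDr opprD addrA.
split=> [|w]; first by rewrite subr_ge0 ltW.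
rewrite qE -scalerAl (pnormZ_real phi_pos); last by rewrite subr_ge0 ltW.
rewrite ler_pM2l ?subr_gt0 //.
rewrite -[leRHS]mul1r; apply: psq_le => //; rewrite expr1n mul1r.
rewrite mulrBl mul1r -scalerAl pformBl !pformBr !pformZl // !pformZr //.
rewrite (pformC phi_pos (t * w) w) !pform_t.
have H : pform phi (t * w) (t * w) <= N ^+ 2 * pform phi (y * w) (y * w).
  rewrite -mulrA -!pnorm_sqr // -exprMn ler_pXn2r ?nnegrE ?mulr_ge0 ?pnorm_ge0 ?(ltW N0) //.
  by have [_] := lbound_star phi_pos yN.
rewrite -!pform_t in H *.
set a := pform phi w (t * w) in H *.
have a0 : 0 <= a by rewrite /a pform_t pform_ge0.
have : N ^- 2 * pform phi (t * w) (t * w) <= a by rewrite mulrC ler_pdivrMr ?exprn_gt0 // mulrC.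
rewrite pform_t => H'.
have n0 : 0 <= N ^- 2 by rewrite invr_ge0 exprn_ge0 // ltW.
have := ler_wpM2l n0 H'.
have := mulr_ge0 n0 a0.
set v1 := N ^- 2 * a.
set v2 := N ^- 2 * (N ^- 2 * _).
lra.
Qed.

(** The even exponent turns <w, q^(2J) w> into |q^J w|^2, which dominates |q^(2J) w|^2; so the
    expansion of |w - q^(2J) w|^2 stays below |w|^2. *)
Lemma lbound_one_sub_trunc_q (J : nat) : lbound phi (1 - trunc_q c t ^+ J.*2) 1.
Proof.
split=> // w; apply: psq_le => //; rewrite expr1n mul1r.
set q := trunc_q c t.
have sq : star q = q.
  rewrite /q /trunc_q starB star1 starZ starD star1 starM starK.
  by congr (_ - _ *: _); exact: conjc_real.
have sqJ u v : pform phi u (q ^+ J * v) = pform phi (q ^+ J * u) v.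
  by rewrite pform_mulr // starX sq.
rewrite mulrBl mul1r pformBl !pformBr (pformC phi_pos _ w).
have -> : pform phi w (q ^+ J.*2 * w) = pform phi (q ^+ J * w) (q ^+ J * w).
  by rewrite -addnn exprD -mulrA sqJ.
have H : pform phi (q ^+ J.*2 * w) (q ^+ J.*2 * w) <= pform phi (q ^+ J * w) (q ^+ J * w).
  rewrite -!pnorm_sqr // ler_pXn2r ?nnegrE ?pnorm_ge0 //.
  rewrite -addnn exprD -mulrA.
  have [q0 /(_ (q ^+ J * w)) qJ] := lboundX J lbound_trunc_q.
  apply: le_trans qJ _; rewrite ler_piMl ?pnorm_ge0 // exprn_ile1 //.
    by case: lbound_trunc_q.
  by have /andP[? _] := trunc_c_itv; rewrite gerDl oppr_le0 ltW.
have := pform_ge0 phi_pos (q ^+ J.*2 * w); lra.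
Qed.

(** With u = hw, the vector (1 + t)u equals (1 - q^(2J))w, and |u| <= |(1 + t)u| because t is
    positive. *)
Lemma lbound_trunc_h J : lbound phi (trunc_h c J.*2 t) 1.
Proof.
split=> // w; rewrite mul1r.
have [_ /(_ w)] := lbound_one_sub_trunc_q J; rewrite mul1r; apply: le_trans.
rewrite -trunc_hE -mulrA; set u := _ * w.
rewrite -[leRHS]mul1r; apply: psq_le => //; rewrite expr1n mul1r.
rewrite mulrDl mul1r pformDl // !pformDr // (pformC phi_pos (t * u) u) pform_t.
have := pform_ge0 phi_pos (y * u); have := pform_ge0 phi_pos (t * u); lra.
Qed.

(** Again with u = hw: |2yu|^2 = 4<u, tu> and |(1 + t)u|^2 differ by |(1 - t)u|^2 >= 0. *)
Lemma lbound_trunc J : lbound phi (trunc c J.*2 y) 1.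
Proof.
split=> // w; rewrite mul1r.
have [_ /(_ w)] := lbound_one_sub_trunc_q J; rewrite mul1r; apply: le_trans.
rewrite -trunc_hE -mulrA /trunc mulrnAl -mulrA; set u := _ * w.
rewrite -[leRHS]mul1r; apply: psq_le => //; rewrite expr1n mul1r.
rewrite mulr2n !(pformDl, pformDr) // !(mulrDl, mul1r) !(pformDl, pformDr) //.
rewrite (pformC phi_pos (t * u) u) (pform_t u u).
have := pform_ge0 phi_pos (u - t * u);
  rewrite pformBl !pformBr (pformC phi_pos (t * u) u) pform_t.
by lra.
Qed.

End Truncation.

(** * The C*-norm *)

Section CStarNorm.
Variables (R : realType) (M : cstarAlgType R).
Implicit Types x y z : M.

Lemma cnormD x y : cnorm (x + y) <= cnorm x + cnorm y.
Proof. by have [H _ _] := cnorm_is_norm (s := M); exact: H. Qed.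

Lemma cnormZ c x : cnorm (c *: x) = complex.Re `|c| * cnorm x.
Proof. by have [_ H _] := cnorm_is_norm (s := M); exact: H. Qed.

Lemma cnorm0_eq0 x : cnorm x = 0 -> x = 0.
Proof. by have [_ _ H] := cnorm_is_norm (s := M); exact: H. Qed.

Lemma cnormN x : cnorm (- x) = cnorm x.
Proof. by rewrite -scaleN1r cnormZ normrN1 mul1r. Qed.

Lemma cnorm0 : cnorm (0 : M) = 0.
Proof. by rewrite -(scale0r 0) cnormZ normr0 mul0r. Qed.

Lemma cnorm_ge0 x : 0 <= cnorm x.
Proof. by have := cnormD x (- x); rewrite subrr cnorm0 cnormN; lra. Qed.

Lemma cnormZ_real (t : R) x : 0 <= t -> cnorm (t%:C *: x) = t * cnorm x.
Proof. by move=> t0; rewrite cnormZ ger0_norm ?ler0c. Qed.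

Lemma cnormB_le x y z : cnorm (x - z) <= cnorm (x - y) + cnorm (y - z).
Proof. by have := cnormD (x - y) (y - z); rewrite addrA subrK. Qed.

Lemma cnormBC x y : cnorm (x - y) = cnorm (y - x).
Proof. by rewrite -cnormN opprB. Qed.

Lemma cnorm_starE x : cnorm (star x) = cnorm x.
Proof.
have le z : cnorm z <= cnorm (star z).
  have [->|z0] := eqVneq (cnorm z) 0; first exact: cnorm_ge0.
  have zp : 0 < cnorm z by rewrite lt_def z0 cnorm_ge0.
  by rewrite -(ler_pM2r zp) -expr2 -cnorm_star cnormM.
by apply/eqP; rewrite eq_le le andbT -{2}(starK x) le.
Qed.

Lemma geometric_cvg (u : nat -> M) (q : R) : 0 <= q < 1 ->
  (forall n, cnorm (u n.+2 - u n.+1) <= q * cnorm (u n.+1 - u n)) ->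
  forall e, 0 < e -> exists n0, forall n, (n0 <= n)%N -> forall k,
    cnorm (u (n + k)%N - u n) < e.
Proof.
move=> /andP[q0 q1] H e e0; set C := cnorm (u 1%N - u 0%N).
have C0 : 0 <= C by exact: cnorm_ge0.
have step n : cnorm (u n.+1 - u n) <= q ^+ n * C.
  elim: n => [|n IH]; first by rewrite mul1r.
  by apply: le_trans (H n) _; rewrite exprS -mulrA ler_wpM2l.
have q1' : 0 < 1 - q by rewrite subr_gt0.
have sum n k : cnorm (u (n + k)%N - u n) <= q ^+ n * C * ((1 - q ^+ k) / (1 - q)).
  elim: k => [|k IH]; first by rewrite addn0 subrr cnorm0 subrr mul0r mulr0.
  apply: le_trans (cnormB_le _ (u (n + k)%N) _) _.
  apply: le_trans (lerD _ IH) _; first by rewrite addnS; exact: step.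
  have -> : q ^+ n * C * ((1 - q ^+ k.+1) / (1 - q)) =
     q ^+ (n + k) * C + q ^+ n * C * ((1 - q ^+ k) / (1 - q)).
    by rewrite exprD exprS; field; rewrite gt_eqF.
  by [].
have [n0 Hn0] : exists n0, forall n, (n0 <= n)%N -> q ^+ n * C / (1 - q) < e.
  have : q ^+ n @[n --> \oo] --> (0 : R) by apply: cvg_expr; rewrite ger0_norm.
  move=> /cvgrPdist_lt /(_ (e * (1 - q) / (C + 1))).
  have C1 : 0 < C + 1 by lra.
  move=> /(_ (divr_gt0 (mulr_gt0 e0 q1') C1)) [n0 _ Hn].
  exists n0 => n /Hn /=; rewrite sub0r normrN ger0_norm ?exprn_ge0 // => Hq.
  rewrite ltr_pdivrMr //; apply: le_lt_trans (_ : q ^+ n * (C + 1) < _).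
    by rewrite ler_wpM2l ?exprn_ge0 // lerDl.
  by rewrite -ltr_pdivlMr.
exists n0 => n /Hn0 Hn k; apply: le_lt_trans Hn; apply: le_trans (sum _ _) _.
rewrite ler_wpM2l ?mulr_ge0 ?exprn_ge0 // -[leRHS]mul1r ler_pM2r ?invr_gt0 //.
by rewrite gerBl exprn_ge0.
Qed.

Lemma geometric_limit (u : nat -> M) (q : R) : 0 <= q < 1 ->
  (forall n, cnorm (u n.+2 - u n.+1) <= q * cnorm (u n.+1 - u n)) ->
  exists w, forall e, 0 < e -> exists n0, forall n, (n0 <= n)%N ->
    cnorm (u n - w) < e.
Proof.
move=> q01 H; have gc := geometric_cvg q01 H.
have [n|e e0|w _ /cvgrPdist_lt Hw] := @cnorm_complete R M u; first by [].
  have [n0 Hn0] := gc _ (divr_gt0 e0 (ltr0Sn R 1)); exists n0 => m n Hm Hn.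
  apply: le_lt_trans (cnormB_le _ (u n0) _) _; rewrite [ltRHS]splitr ltrD //.
    by rewrite -(subnKC Hm) Hn0.
  by rewrite cnormBC -(subnKC Hn) Hn0.
exists w => e e0; have [n0 _ Hn] := Hw e e0; exists n0 => n /Hn /=.
by rewrite sub0r normrN ger0_norm ?cnorm_ge0.
Qed.

Lemma eq_cnormB x y : (forall e, 0 < e -> cnorm (x - y) < e) -> x = y.
Proof.
move=> H; apply/eqP; rewrite -subr_eq0; apply/eqP/cnorm0_eq0/eqP.
rewrite eq_le cnorm_ge0 andbT; apply/ler_addgt0Pl => e /H /ltW; by rewrite addr0.
Qed.

Lemma cnormB_mul x y z w (b : R) : cnorm x <= b -> cnorm w <= b ->
  cnorm (x * y - z * w) <= b * (cnorm (x - z) + cnorm (y - w)).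
Proof.
move=> xb wb.
have -> : x * y - z * w = x * (y - w) + (x - z) * w.
  by rewrite mulrBr mulrBl addrA subrK.
apply: le_trans (cnormD _ _) _; rewrite [leRHS]mulrDr [leLHS]addrC.
apply: lerD; apply: le_trans (cnormM _ _) _.
  by rewrite mulrC ler_wpM2r ?cnorm_ge0.
by rewrite ler_wpM2r ?cnorm_ge0.
Qed.

(* The square root is [1 - w], where [w] is the fixed point of the contraction
   w |-> (x + w^2) / 2. *)
Lemma selfadjoint_sqrt x : star x = x -> cnorm x < 1 ->
  exists2 s, star s = s & s * s = 1 - x.
Proof.
move=> sx x1; set r := cnorm x in x1 *; have r0 : 0 <= r by exact: cnorm_ge0.
pose f w := (2^-1 : R)%:C *: (x + w * w).
have half0 : 0 <= 2^-1 :> R by rewrite invr_ge0.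
(* Squaring is 2r-Lipschitz on the ball of radius r, and the factor 1/2 leaves the constant r < 1.
   The ball is preserved as (r + r^2)/2 <= r. *)
have fB w w' : cnorm w <= r -> cnorm w' <= r -> cnorm (f w - f w') <= r * cnorm (w - w').
  move=> wr wr'; rewrite /f -scalerBr cnormZ_real // opprD addrACA subrr add0r.
  have := cnormB_mul w w' wr wr'; lra.
pose u n := iter n f 0.
have ur n : cnorm (u n) <= r.
  elim: n => [|n IH]; first by rewrite cnorm0.
  rewrite /u iterS -/(u n) /f cnormZ_real //.
  have := cnormD x (u n * u n); have := cnormM (u n) (u n).
  have := cnorm_ge0 (u n); rewrite -/r; nra.
have us n : star (u n) = u n.
  elim: n => [|n IH]; first exact: star0.
  rewrite /u iterS -/(u n) /f starZ starD starM IH sx.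
  by congr (_ *: _); exact: conjc_real.
have [|n|w Hw] := @geometric_limit u r; first by rewrite r0.
  exact: (fB (u n.+1) (u n) (ur _) (ur _)).
have wr : cnorm w <= r.
  apply/ler_addgt0Pl => e e0; have [n0 /(_ _ (leqnn _)) Hn] := Hw e e0.
  have := cnormD (u n0) (w - u n0); rewrite addrC subrK cnormBC.
  have := ur n0; lra.
have fw : f w = w.
  apply: eq_cnormB => e e0.
  have [n0 Hn] := Hw (e / 2) (divr_gt0 e0 (ltr0Sn R 1)).
  have H1 := Hn _ (leqnn n0); have H2 := Hn _ (leqnSn n0).
  apply: le_lt_trans (cnormB_le _ (u n0.+1) _) _.
  have := fB w (u n0) wr (ur n0); rewrite -/(u n0.+1) (cnormBC w).
  have := cnorm_ge0 (u n0 - w).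
  have -> : f (u n0) = u n0.+1 by [].
  nra.
have sw : star w = w.
  apply: eq_cnormB => e e0.
  have [n0 /(_ _ (leqnn _)) Hn] := Hw (e / 2) (divr_gt0 e0 (ltr0Sn R 1)).
  apply: le_lt_trans (cnormB_le _ (u n0) _) _.
  rewrite [ltRHS]splitr ltrD //.
  by rewrite -{1}(us n0) -starB cnorm_starE cnormBC.
exists (1 - w); first by rewrite starB star1 sw.
have w2 : w + w = x + w * w.
  rewrite -mulr2n -[in LHS]fw /f -scaler_nat scalerA.
  have -> : 2%:R * (2^-1 : R)%:C = 1 :> R[i].
    by rewrite -(rmorph_nat (real_complex R)) -rmorphM divff.
  by rewrite scale1r.
have ww : w - w * w = x - w.
  by apply/eqP; rewrite subr_eq addrAC eq_sym subr_eq w2.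
by rewrite mulrBl mul1r mulrBr mulr1 ww opprB addrA subrK.
Qed.

(** For K above the norm of y, put v = y/K. Then 1 - v^*v = s^2 with s self-adjoint, and positivity
    of [phi] at [star (s * w) * (s * w)] says |yw| <= K|w|. The square root needs the strict
    inequality; K then decreases to the norm of y. *)
Lemma lbound_cnorm (phi : M -> R[i]) y : positive_functional phi ->
  lbound phi y (cnorm y).
Proof.
move=> pos; split=> [|w]; first exact: cnorm_ge0.
have H K : cnorm y < K -> pnorm phi (y * w) <= K * pnorm phi w.
  move=> yK; have K0 : 0 < K by apply: le_lt_trans yK; exact: cnorm_ge0.
  pose v := (K^-1)%:C *: y.
  have v1 : cnorm v < 1.
    by rewrite cnormZ_real ?invr_ge0 1?ltW // mulrC ltr_pdivrMr // mul1r.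
  have [||s ss sE] := @selfadjoint_sqrt (star v * v); first by rewrite starM starK.
    by rewrite cnorm_star expr_lt1 ?cnorm_ge0.
  have := pform_ge0 pos (s * w).
  rewrite -{1}ss -pform_mulr mulrA sE mulrBl mul1r pformDr //.
  rewrite -scaleN1r -(rmorphN1 (real_complex R)) pformZr // mulN1r.
  rewrite -mulrA pform_mulr // starK subr_ge0 -!pnorm_sqr //.
  rewrite ler_pXn2r ?nnegrE ?pnorm_ge0 // -scalerAl (pnormZ_real pos); last first.
    by rewrite invr_ge0 ltW.
  by rewrite [leLHS]mulrC ler_pdivrMr // mulrC.
have [w0|w0] := eqVneq (pnorm phi w) 0.
  by have := H (cnorm y + 1); rewrite w0 !mulr0; apply; rewrite ltrDl.
have wp : 0 < pnorm phi w by rewrite lt_def w0 pnorm_ge0.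
rewrite -ler_pdivrMr //; apply/ler_addgt0Pr => e e0.
by rewrite ler_pdivrMr // H // ltrDl.
Qed.

End CStarNorm.

(** * The Kaplansky density theorem *)

Section PolynomialBounds.
Variables (R : realType) (I : choiceType).

Lemma lbound_sum (A : starAlgType R[i]) (phi : A -> R[i]) (T : Type) (s : seq T)
    (F : T -> A) (N : T -> R) : positive_functional phi ->
  (forall t, lbound phi (F t) (N t)) ->
  lbound phi (\sum_(t <- s) F t) (\sum_(t <- s) N t).
Proof.
move=> pos H; elim: s => [|t s IH]; first by rewrite !big_nil; exact: lbound0.
by rewrite !big_cons; exact: lboundD.
Qed.

Lemma lbound_prod (A : starAlgType R[i]) (phi : A -> R[i]) (T : Type) (s : seq T)
    (F : T -> A) (N : T -> R) :
  (forall t, lbound phi (F t) (N t)) ->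
  lbound phi (\prod_(t <- s) F t) (\prod_(t <- s) N t).
Proof.
move=> H; elim: s => [|t s IH]; first by rewrite !big_nil; exact: lbound1.
by rewrite !big_cons; exact: lboundM.
Qed.

Lemma lbound_ev_letter (A : starAlgType R[i]) (phi : A -> R[i]) (r : I -> R)
    (z : I -> A) s : positive_functional phi ->
  (forall i, lbound phi (z i) (r i)) -> lbound phi (ev_letter z s) (r s.1).
Proof. by case: s => i [] pos H; rewrite /ev_letter /=; [exact: lbound_star|]. Qed.

(** The sum of the moduli of the coefficients, weighted by products of cutoffs, depends on [P] and
    [r] only; this uniformity carries estimates from [M] over to matrices of every size. *)
Lemma lbound_ev (r : I -> R) (P : starpoly R[i] I) : exists N : R,
  forall (A : starAlgType R[i]) (phi : A -> R[i]) (z : I -> A),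
    positive_functional phi -> (forall i, lbound phi (z i) (r i)) ->
    lbound phi (ev z P) N.
Proof.
exists (\sum_(w <- msupp P) complex.Re `|mcoeff w P| *
  \prod_(s <- fmonom_val w) r s.1) => A phi z pos H.
apply: lbound_sum => // w; apply: lboundZ => //.
by apply: lbound_prod => s; exact: lbound_ev_letter.
Qed.

End PolynomialBounds.

(** * The uniform trace norm and the closures C*_X *)

Section TracialNorm.
Variables (R : realType) (M : cstarAlgType R) (X : set (M -> R[i])).
Hypothesis hX : tracially_complete X.

Lemma state_pos tau : X tau -> positive_functional tau.
Proof. by move=> /(tc_tracial hX)[]. Qed.

Lemma state_tracial tau : X tau -> tracial tau.
Proof. by move=> /(tc_tracial hX)[]. Qed.

Lemma state_pnorm1 tau : X tau -> pnorm tau 1 = 1.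
Proof.
by move=> /(tc_tracial hX)[_ t1 _ _]; rewrite /pnorm /pform star1 mul1r t1 sqrtr1.
Qed.

Lemma state_pnorm_le tau x : X tau -> pnorm tau x <= cnorm x.
Proof.
move=> Xt; have [_ /(_ 1)] := lbound_cnorm x (state_pos Xt).
by rewrite mulr1 state_pnorm1 // mulr1.
Qed.

Lemma tracially_complete_nonempty : X !=set0.
Proof.
apply/set0P/eqP => X0; have [_ _ /(_ 1)] := tc_norm hX.
by rewrite /norm2X X0 image_set0 sup0 => /(_ erefl) /eqP; rewrite oner_eq0.
Qed.

Lemma pnorm_le_norm2X tau x : X tau -> pnorm tau x <= norm2X X x.
Proof.
move=> Xt; apply: ub_le_sup; last by exists tau.
by exists (cnorm x) => _ [sigma Xs <-]; exact: state_pnorm_le.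
Qed.

Lemma norm2X_le x e : (forall tau, X tau -> pnorm tau x <= e) -> norm2X X x <= e.
Proof.
move=> H; apply: ge_sup; last by move=> _ [tau Xt <-]; exact: H.
by have [tau Xt] := tracially_complete_nonempty; exists (pnorm tau x), tau.
Qed.

Lemma cstarXP (I : choiceType) (x : I -> M) (y : M) : cstarX X x y <->
  forall e : R, 0 < e -> exists P : starpoly R[i] I,
    forall tau, X tau -> pnorm tau (y - ev x P) <= e.
Proof.
split=> H e e0.
  have [P HP] := H e e0; exists P => tau Xt.
  exact: le_trans (pnorm_le_norm2X _ Xt) (ltW HP).
have [P HP] := H (e / 2) (divr_gt0 e0 (ltr0Sn R 1)); exists P.
by apply: le_lt_trans (norm2X_le HP) _; rewrite ltr_pdivrMr // ltr_pMr // ltr1n.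
Qed.

Section Closure.
Variables (I : choiceType) (x : I -> M).

Lemma cstarX_ev P : cstarX X x (ev x P).
Proof.
by apply/cstarXP => e e0; exists P => tau Xt; rewrite subrr (pnorm0 (state_pos Xt)) ltW.
Qed.

Lemma cstarXD y z : cstarX X x y -> cstarX X x z -> cstarX X x (y + z).
Proof.
move=> /cstarXP Hy /cstarXP Hz; apply/cstarXP => e e0.
have e2 : 0 < e / 2 by rewrite divr_gt0.
have [P HP] := Hy _ e2; have [Q HQ] := Hz _ e2; exists (P + Q) => tau Xt.
rewrite evD opprD addrACA (splitr e); apply: le_trans (pnormD (state_pos Xt) _ _) _.
by rewrite lerD ?HP ?HQ.
Qed.

Lemma cstarX_star y : cstarX X x y -> cstarX X x (star y).
Proof.
move=> /cstarXP Hy; apply/cstarXP => e /Hy[P HP]; exists (star P) => tau Xt.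
by rewrite ev_star -starB pnorm_star ?HP //; exact: state_tracial.
Qed.

Lemma pnormMl_cnorm tau y z : X tau -> pnorm tau (y * z) <= cnorm y * pnorm tau z.
Proof. by move=> /state_pos/(lbound_cnorm y)[]. Qed.

Lemma pnormMr_cnorm tau y z : X tau -> pnorm tau (z * y) <= cnorm y * pnorm tau z.
Proof.
move=> Xt; apply: pnormMr; [exact: state_pos|exact: state_tracial|].
exact/lbound_cnorm/state_pos.
Qed.

Lemma cstarXM y z : cstarX X x y -> cstarX X x z -> cstarX X x (y * z).
Proof.
move=> /cstarXP Hy /cstarXP Hz; apply/cstarXP => e e0.
have small (b : R) : 0 <= b -> 0 < e / 2 / (b + 1) /\ b * (e / 2 / (b + 1)) <= e / 2.
  move=> b0; have b1 : 0 < b + 1 by lra.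
  split; first by rewrite !divr_gt0.
  by rewrite mulrA ler_pdivrMr //; lra.
(* Multiplication is not jointly continuous in the trace norm: [Q] is fixed before [P], whose
   tolerance depends on the operator norm of [ev x Q]. *)
have [e1 He1] := small _ (cnorm_ge0 y); have [Q HQ] := Hz _ e1.
have [e2 He2] := small _ (cnorm_ge0 (ev x Q)); have [P HP] := Hy _ e2.
exists (P * Q) => tau Xt.
have -> : y * z - ev x (P * Q) = y * (z - ev x Q) + (y - ev x P) * ev x Q.
  by rewrite evM mulrBr mulrBl addrA subrK.
rewrite (splitr e); apply: le_trans (pnormD (state_pos Xt) _ _) _.
apply: lerD.
  apply: le_trans (pnormMl_cnorm _ _ Xt) (le_trans _ He1).
  by rewrite ler_wpM2l ?cnorm_ge0 // HQ.
apply: le_trans (pnormMr_cnorm _ _ Xt) (le_trans _ He2).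
by rewrite ler_wpM2l ?cnorm_ge0 // HP.
Qed.

Lemma cstarX1 : cstarX X x 1.
Proof. by rewrite -(ev1 x); exact: cstarX_ev. Qed.

Lemma cstarXZ c y : cstarX X x y -> cstarX X x (c *: y).
Proof.
move=> Hy; rewrite -[y]mul1r scalerAl; apply: cstarXM => //.
by rewrite -(ev1 x) -evZ; exact: cstarX_ev.
Qed.

End Closure.

(** The norm of y is not under control. On the right y occurs alone only inside the product hy,
    which has left bound 1 in the application; every other occurrence is in a difference y - d or ys
    - ds, small in the trace norm. *)
Lemma cayley_identity (h y d ys ds m : M) :
  h * y *+ 2 - h * (1 + y * ys) * m =
  h * (y - d) *+ 2 - h * y * ((ys - ds) * m) - h * ((y - d) * (ds * m))
    + h * (d *+ 2 - (1 + d * ds) * m).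
Proof.
have e : y * ((ys - ds) * m) + (y - d) * (ds * m) + (1 + d * ds) * m
    = (1 + y * ys) * m.
  by rewrite !mulrA -!mulrDl mulrBr mulrBl [X in X + _]addrA subrK addrCA subrK.
rewrite -!mulrnAr -!mulrA -!mulrBr -mulrDr -e; congr (h * _).
set a := y * _; set b := (y - d) * _; set f := (1 + _) * m.
rewrite mulrnBl addrA [_ - b + _]addrAC [_ - a + _]addrAC subrK.
by rewrite !opprD !addrA.
Qed.

Section Kaplansky.
Variables (I : choiceType) (x : I -> M) (r : I -> R).
Hypothesis xr : forall i, cnorm (x i) <= r i.

(* If 2d = (1 + dd^* )m then m = 2d(1 + d^*d)^-1, which [trunc] approximates. *)
Lemma contraction_cayley (m : M) : cnorm m < 1 -> cstarX X x m ->
  forall e, 0 < e -> exists d, [/\ cstarX X x d, cnorm d <= 1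
    & cnorm (d *+ 2 - (1 + d * star d) * m) < e].
Proof.
move=> m1 Hm e e0.
have half0 : 0 <= 2^-1 :> R by rewrite invr_ge0.
(* The map preserves the unit ball and contracts it with the norm of m as constant. The residual of
   an iterate is twice the next step, so a late iterate suffices and no limit has to be placed in
   [cstarX]. *)
pose f d := (2^-1 : R)%:C *: ((1 + d * star d) * m).
pose u n := iter n f 0.
have m0 := cnorm_ge0 m.
have c1 : cnorm (1 : M) <= 1.
  have := cnorm_star (1 : M); rewrite star1 mul1r.
  by have := cnorm_ge0 (1 : M); nra.
have u1 n : cnorm (u n) <= 1.
  elim: n => [|n IH]; first by rewrite cnorm0.
  rewrite /u iterS -/(u n) /f cnormZ_real //.
  have := cnormM (1 + u n * star (u n)) m.
  have := cnormD 1 (u n * star (u n)); have := cnormM (u n) (star (u n)).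
  rewrite cnorm_starE; have := cnorm_ge0 (u n).
  have := cnorm_ge0 (1 + u n * star (u n)); nra.
have step n : cnorm (u n.+2 - u n.+1) <= cnorm m * cnorm (u n.+1 - u n).
  rewrite {1}/u iterS -/(u n.+1) [X in _ - X]/u iterS -/(u n) /f.
  rewrite -scalerBr cnormZ_real // -mulrBl opprD addrACA subrr add0r.
  have us : cnorm (star (u n)) <= 1 by rewrite cnorm_starE.
  have := cnormB_mul (star (u n.+1)) (u n) (u1 n.+1) us.
  rewrite -starB cnorm_starE mul1r => H.
  have := cnormM (u n.+1 * star (u n.+1) - u n * star (u n)) m.
  have := cnorm_ge0 (u n.+1 - u n).
  have := ler_wpM2r m0 H; lra.
have uX n : cstarX X x (u n).
  elim: n => [|n IH]; first by rewrite /u /= -(scale0r 1); exact/cstarXZ/cstarX1.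
  rewrite /u iterS -/(u n) /f; apply/cstarXZ/cstarXM => //.
  by apply: cstarXD; [exact: cstarX1 | apply: cstarXM => //; exact: cstarX_star].
have q01 : 0 <= cnorm m < 1 by rewrite m0.
have [n0 /(_ n0 (leqnn _) 1)] := geometric_cvg q01 step (divr_gt0 e0 (ltr0Sn R 1)).
rewrite addn1 => Hn; exists (u n0); split=> //.
have -> : u n0 *+ 2 - (1 + u n0 * star (u n0)) * m = (2%:R : R)%:C *: (u n0 - u n0.+1).
  rewrite scalerBr [in u n0.+1]/u iterS -/(u n0) /f scalerA -rmorphM divff //.
  by rewrite scale1r rmorph_nat scaler_nat.
by rewrite cnormZ_real // cnormBC mulrC -ltr_pdivlMr.
Qed.

(** A polynomial close to [d] in the trace norm may be large; truncating it restores the bound 1 for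
    all functionals at once, while [cayley_identity] keeps the result close to [m]. *)
Lemma kaplansky_contraction (m : M) : cnorm m < 1 -> cstarX X x m ->
  forall e, 0 < e -> exists P : starpoly R[i] I,
    (forall tau, X tau -> pnorm tau (m - ev x P) <= e) /\
    (forall (A : starAlgType R[i]) (phi : A -> R[i]) (z : I -> A),
       positive_functional phi -> (forall i, lbound phi (z i) (r i)) ->
       lbound phi (ev z P) 1).
Proof.
(* Six error terms: the one in h(y - d) counts twice, the other four once. *)
move=> m1 Hm e e0; have e6 : 0 < e / 6 by rewrite divr_gt0.
have [d [dX d1 dm]] := contraction_cayley m1 Hm e6.
have [P HP] := (cstarXP x d).1 dX _ e6.
have [N0 HN0] := lbound_ev r P.
(* The maximum with 1 keeps N positive, as the factor N^-2 in the truncation estimate requires. *)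
pose N := Num.max 1 N0; have N1 : 1 <= N by rewrite le_max lexx.
have HN (A : starAlgType R[i]) (phi : A -> R[i]) (z : I -> A) :
    positive_functional phi -> (forall i, lbound phi (z i) (r i)) ->
    lbound phi (ev z P) N.
  by move=> pos zr; apply: lbound_le (HN0 _ _ _ pos zr); rewrite le_max lexx orbT.
have /andP[c0 c1] := trunc_c_itv N1; set c := trunc_c N in c0 c1.
have [J HJ] : exists J, (1 - c) ^+ J.*2 <= e / 6.
  have : (1 - c) ^+ n @[n --> \oo] --> (0 : R).
    by apply: cvg_expr; rewrite ger0_norm ?subr_ge0 ?ltW // gtrDl oppr_lt0.
  move=> /cvgrPdist_lt /(_ _ e6)[J _ /(_ J.*2) HJ]; exists J.
  move: HJ; rewrite /= -addnn leq_addr => /(_ isT).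
  by rewrite sub0r normrN => /ltW; apply: le_trans; exact: ler_norm.
exists (trunc c J.*2 P); split=> [tau Xt|A phi z pos zr]; last first.
  by rewrite ev_trunc; apply: lbound_trunc => //; exact: HN.
have pos := state_pos Xt; have tr := state_tracial Xt.
rewrite ev_trunc; set y := ev x P.
have yN : lbound tau y N.
  apply: HN => // i; apply: (lbound_le (xr i)); exact: lbound_cnorm.
(* The inverse is moved to the left, where it is a function of [y * star y]; hence the truncation
   estimates are taken at [star y]. *)
have ysN := lbound_star pos yN.
have ytr := lbound_trunc pos N1 yN J.
have hs := lbound_trunc_h pos N1 ysN J.
have qs := lboundX J.*2 (lbound_trunc_q pos N1 ysN).
rewrite starK -/c in hs qs ytr.
set h := trunc_h c J.*2 (y * star y) in hs.
have yd : pnorm tau (y - d) <= e / 6 by rewrite -pnormN // opprB HP.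
have mE : m = h * (1 + y * star y) * m + trunc_q c (y * star y) ^+ J.*2 * m.
  by rewrite -trunc_hC trunc_hE -mulrDl subrK mul1r.
have trE : trunc c J.*2 y = h * y *+ 2 by rewrite /trunc trunc_h_star.
have dec : trunc c J.*2 y - m = h * (y - d) *+ 2 - h * y * (star (y - d) * m)
   - h * ((y - d) * (star d * m)) + h * (d *+ 2 - (1 + d * star d) * m)
   - trunc_q c (y * star y) ^+ J.*2 * m.
  by rewrite trE {1}mE opprD addrA starB -(cayley_identity h y d (star y) (star d)).
have ms1 : cnorm m <= 1 by exact: ltW.
have nm : pnorm tau m <= 1 by exact: le_trans (state_pnorm_le _ Xt) _.
have B0 v : pnorm tau (h * v) <= pnorm tau v by have [_ /(_ v)] := hs; rewrite mul1r.
have B1 : pnorm tau (h * (y - d)) <= e / 6 by exact: le_trans (B0 _) _.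
have B2 : pnorm tau (h * y * (star (y - d) * m)) <= e / 6.
  have H v : pnorm tau (h * y * v) <= pnorm tau v.
    have [_ /(_ v)] := ytr; rewrite trE mulrnAl mul1r -scaler_nat.
    rewrite -(rmorph_nat (real_complex R)) (pnormZ_real pos) //.
    by have := pnorm_ge0 tau (h * y * v); lra.
  apply: le_trans (H _) _; apply: le_trans (pnormMr_cnorm _ _ Xt) _.
  by rewrite pnorm_star //; apply: le_trans yd; rewrite ler_piMl ?pnorm_ge0.
have B3 : pnorm tau (h * ((y - d) * (star d * m))) <= e / 6.
  apply: le_trans (B0 _) _; apply: le_trans (pnormMr_cnorm _ _ Xt) _.
  apply: le_trans yd; rewrite ler_piMl ?pnorm_ge0 //.
  by apply: le_trans (cnormM _ _) _; rewrite cnorm_starE mulr_ile1 ?cnorm_ge0.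
have B4 : pnorm tau (h * (d *+ 2 - (1 + d * star d) * m)) <= e / 6.
  by apply: le_trans (B0 _) _; apply: le_trans (state_pnorm_le _ Xt) (ltW _).
have B5 : pnorm tau (trunc_q c (y * star y) ^+ J.*2 * m) <= e / 6.
  have [q0 /(_ m)] := qs; move/le_trans; apply; rewrite -[leRHS]mulr1.
  by rewrite ler_pM ?pnorm_ge0.
rewrite -pnormN // opprB dec.
have := pnormB pos (h * (y - d) *+ 2 - h * y * (star (y - d) * m)
   - h * ((y - d) * (star d * m)) + h * (d *+ 2 - (1 + d * star d) * m))
   (trunc_q c (y * star y) ^+ J.*2 * m).
have := pnormD pos (h * (y - d) *+ 2 - h * y * (star (y - d) * m)
   - h * ((y - d) * (star d * m))) (h * (d *+ 2 - (1 + d * star d) * m)).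
have := pnormB pos (h * (y - d) *+ 2 - h * y * (star (y - d) * m))
  (h * ((y - d) * (star d * m))).
have := pnormB pos (h * (y - d) *+ 2) (h * y * (star (y - d) * m)).
have := pnormD pos (h * (y - d)) (h * (y - d)); rewrite -mulr2n.
lra.
Qed.

(** Only strict contractions are covered so far; [m] is shrunk slightly, rescaled into the open unit
    ball, and the result multiplied by [s]. *)
Lemma kaplansky (m : M) (s : R) : cnorm m <= s -> cstarX X x m ->
  forall e, 0 < e -> exists P : starpoly R[i] I,
    (forall tau, X tau -> pnorm tau (m - ev x P) <= e) /\
    (forall (A : starAlgType R[i]) (phi : A -> R[i]) (z : I -> A),
       positive_functional phi -> (forall i, lbound phi (z i) (r i)) ->
       lbound phi (ev z P) s).
Proof.
move=> ms Hm e e0; have m0 := cnorm_ge0 m.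
have [s0|s0] := leP s 0.
  have -> : s = 0 by apply/eqP; rewrite eq_le s0 (le_trans m0).
  have -> : m = 0 by apply: cnorm0_eq0; apply/eqP; rewrite eq_le m0 (le_trans ms).
  exists 0; split=> [tau Xt|A phi z pos _]; rewrite (raddf0 (ev _)).
    by rewrite subr0 (pnorm0 (state_pos Xt)) ltW.
  exact: lbound0.
(* The loss is m - s(tm) = km, and this k makes ks at most e/2 while staying below 1. *)
pose k := e / 2 / (e + s); have es : 0 < e + s by rewrite addr_gt0.
have k0 : 0 < k by rewrite !divr_gt0.
have k1 : k < 1 by rewrite /k ltr_pdivrMr //; lra.
have ks : k * s <= e / 2 by rewrite /k mulrAC ler_pdivrMr //; nra.
pose t := (1 - k) / s; have t0 : 0 < t by rewrite divr_gt0 // subr_gt0.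
have tm : cnorm (t%:C *: m) < 1.
  rewrite cnormZ_real 1?ltW // /t mulrAC ltr_pdivrMr // mul1r.
  by apply: le_lt_trans (_ : (1 - k) * s < _); nra.
have es2 : 0 < e / 2 / s by rewrite !divr_gt0.
have [P [HP HA]] := kaplansky_contraction tm (cstarXZ t%:C Hm) es2.
have sR : complex.Re `|s%:C| = s by rewrite ger0_norm ?ler0c // ltW.
exists (s%:C *: P); split=> [tau Xt|A phi z pos zr]; rewrite evZ; last first.
  have := lboundZ pos s%:C (HA _ _ _ pos zr); rewrite sR mulr1; exact.
have pos := state_pos Xt.
have -> : m - s%:C *: ev x P = k%:C *: m + s%:C *: (t%:C *: m - ev x P).
  rewrite scalerBr addrA scalerA -rmorphM -scalerDl -rmorphD.
  have -> : k + s * t = 1 by rewrite /t; field; rewrite gt_eqF.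
  by rewrite rmorph1 scale1r.
apply: le_trans (pnormD pos _ _) _; rewrite !(pnormZ_real pos) ?(ltW k0) ?(ltW s0) //.
rewrite (splitr e) lerD //.
  apply: le_trans ks; rewrite ler_pM2l //.
  exact: le_trans (state_pnorm_le _ Xt) ms.
by rewrite mulrC -ler_pdivlMr // HP.
Qed.

End Kaplansky.
End TracialNorm.

(** * Uniform continuity of *-polynomials *)

Section Lipschitz.
Variables (R : realType) (I : choiceType) (r : I -> R).
Hypothesis r_ge0 : forall i, 0 <= r i.

(** Letters are exchanged one at a time. Traciality enters because the changed letter stands to the
    left of the remaining word, whose bound concerns left multiplication. *)
Let lipschitz_word (s : seq (I * bool)) : exists L : R, 0 <= L /\
  forall (A : starAlgType R[i]) (phi : A -> R[i]) (x y : I -> A),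
    positive_functional phi -> tracial phi ->
    (forall i, lbound phi (x i) (r i)) -> (forall i, lbound phi (y i) (r i)) ->
    pnorm phi (\prod_(t <- s) ev_letter x t - \prod_(t <- s) ev_letter y t)
      <= L * \sum_(t <- s) pnorm phi (x t.1 - y t.1).
Proof.
elim: s => [|t s [L [L0 HL]]].
  exists 0; split=> // A phi x y pos _ _ _.
  by rewrite !big_nil subrr pnorm0 // mulr0.
have N0 : 0 <= \prod_(t <- s) r t.1 by apply: prodr_ge0.
exists (r t.1 * L + \prod_(t <- s) r t.1); split.
  by rewrite addr_ge0 ?mulr_ge0.
move=> A phi x y pos tr xr yr; rewrite !big_cons.
set px := \prod_(i <- s) ev_letter x i; set py := \prod_(i <- s) ev_letter y i.
have -> : ev_letter x t * px - ev_letter y t * py =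
    ev_letter x t * (px - py) + (ev_letter x t - ev_letter y t) * py.
  by rewrite mulrBr mulrBl addrA subrK.
have dt : pnorm phi (ev_letter x t - ev_letter y t) = pnorm phi (x t.1 - y t.1).
  by case: t => i []; rewrite /ev_letter //= -starB pnorm_star.
have [_ /(_ (px - py)) H1] := lbound_ev_letter t pos xr.
have py_bound : lbound phi py (\prod_(t <- s) r t.1).
  by apply: lbound_prod => u; exact: lbound_ev_letter.
have H2 := pnormMr pos tr (ev_letter x t - ev_letter y t) py_bound.
have := pnormD pos (ev_letter x t * (px - py)) ((ev_letter x t - ev_letter y t) * py).
have := HL _ _ _ _ pos tr xr yr; rewrite -/px -/py; move/(ler_wpM2l (r_ge0 t.1)).
rewrite dt in H2; move: H1 H2.
have S0 : 0 <= \sum_(t <- s) pnorm phi (x t.1 - y t.1).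
  by apply: sumr_ge0 => ? _; exact: pnorm_ge0.
have := mulr_ge0 N0 S0.
have := mulr_ge0 (mulr_ge0 (r_ge0 t.1) L0) (pnorm_ge0 phi (x t.1 - y t.1)).
lra.
Qed.

Lemma lipschitz_ev (P : starpoly R[i] I) : exists L : R, exists V : seq I, 0 <= L /\
  forall (A : starAlgType R[i]) (phi : A -> R[i]) (x y : I -> A),
    positive_functional phi -> tracial phi ->
    (forall i, lbound phi (x i) (r i)) -> (forall i, lbound phi (y i) (r i)) ->
    pnorm phi (ev x P - ev y P) <= L * \sum_(i <- V) pnorm phi (x i - y i).
Proof.
rewrite /ev; elim: (msupp P : seq _) => [|w s [L [V [L0 HL]]]].
  exists 0, [::]; split=> // A phi x y pos _ _ _.
  by rewrite !big_nil subrr pnorm0 // mulr0.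
have [Lw [Lw0 HLw]] := lipschitz_word (fmonom_val w); rewrite /ev_letter in HLw.
exists (complex.Re `|mcoeff w P| * Lw + L), ([seq t.1 | t <- fmonom_val w] ++ V).
split; first by rewrite addr_ge0 ?mulr_ge0 ?Re_norm_ge0.
move=> A phi x y pos tr xr yr; rewrite !big_cons big_cat big_map /=.
rewrite opprD addrACA -scalerBr; apply: le_trans (pnormD pos _ _) _.
rewrite pnormZ //.
have := HL _ _ _ _ pos tr xr yr.
have := ler_wpM2l (Re_norm_ge0 (mcoeff w P)) (HLw _ _ _ _ pos tr xr yr).
have c0 := Re_norm_ge0 (mcoeff w P).
have S0 (W : seq I) : 0 <= \sum_(i <- W) pnorm phi (x i - y i).
  by apply: sumr_ge0 => ? _; exact: pnorm_ge0.
have := S0 V; have := S0 [seq t.1 | t <- fmonom_val w]; rewrite big_map /=.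
set a := \sum_(_ <- w) _; set b := \sum_(_ <- V) _.
move=> a0 b0; have := mulr_ge0 L0 a0; have := mulr_ge0 (mulr_ge0 c0 Lw0) b0.
by rewrite /=; lra.
Qed.

Lemma unif_continuous_ev (P : starpoly R[i] I) (e : R) : 0 < e ->
  exists V : seq I, exists2 d : R, 0 < d &
  forall (A : starAlgType R[i]) (phi : A -> R[i]) (x y : I -> A),
    positive_functional phi -> tracial phi ->
    (forall i, lbound phi (x i) (r i)) -> (forall i, lbound phi (y i) (r i)) ->
    (forall i, i \in V -> pnorm phi (x i - y i) <= d) ->
    pnorm phi (ev x P - ev y P) <= e.
Proof.
move=> e0; have [L [V [L0 HL]]] := lipschitz_ev P.
pose k : R := (size V)%:R; have k0 : 0 <= k by exact: ler0n.
have k1 : 0 < L * k + 1 by have := mulr_ge0 L0 k0; lra.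
exists V, (e / (L * k + 1)); first exact: divr_gt0.
move=> A phi x y pos tr xr yr Hd; apply: le_trans (HL _ _ _ _ pos tr xr yr) _.
have : \sum_(i <- V) pnorm phi (x i - y i) <= \sum_(i <- V) e / (L * k + 1).
  by rewrite !big_seq; apply: ler_sum.
rewrite big_const_seq count_predT iter_addr_0 -mulr_natr -/k => H.
apply: le_trans (ler_wpM2l L0 H) _.
have -> : L * (e / (L * k + 1) * k) = e * (L * k) / (L * k + 1).
  by field; rewrite gt_eqF.
by rewrite ler_pdivrMr // ler_pM2l // lerDl.
Qed.

End Lipschitz.

(** * Estimates for states *)

Section States.
Variables (R : realType) (A : starAlgType R[i]) (phi : A -> R[i]).
Hypotheses (pos : positive_functional phi) (phi1 : phi 1 = 1).

(** Cauchy-Schwarz against 1, applied to x, -x, ix and -ix, bounds the real and imaginary parts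
    separately; the factor 2 pays for combining them. *)
Lemma norm_phi_le x : `|phi x| <= (pnorm phi x *+ 2)%:C.
Proof.
have p1 : pnorm phi 1 = 1 by rewrite /pnorm /pform star1 mul1r phi1 sqrtr1.
have Re_le y : complex.Re (phi y) <= pnorm phi y.
  have := pform_CauchySchwarz pos 1 y.
  by rewrite p1 mul1r /pform star1 mul1r.
have phiZ c y : phi (c *: y) = c * phi y.
  have := pos.1 c y 0; rewrite addr0 => ->.
  by have := pos.1 1 0 0; rewrite scaler0 mul1r addr0 -{1}[phi 0]addr0
    => /addrI <-; rewrite addr0.
have := Re_le x; have := Re_le (- x); have := Re_le ('i *: x); have := Re_le (- 'i *: x).
rewrite -[- x]scaleN1r !pnormZ // !phiZ.
have -> : `|- 'i : R[i]| = 1 by rewrite normc_def /= oppr0 expr0n sqrrN expr1n add0r sqrtr1.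
have -> : `|'i : R[i]| = 1 by rewrite normc_def /= expr0n expr1n add0r sqrtr1.
rewrite normrN1 !mul1r; case: (phi x) => a b /= h1 h2 h3 h4.
rewrite normc_def lecR /= -(ler_pXn2r (n := 2)) ?nnegrE ?sqrtr_ge0 ?mulrn_wge0 ?pnorm_ge0 //.
rewrite sqr_sqrtr ?addr_ge0 ?sqr_ge0 //.
have : `|a| <= pnorm phi x by rewrite ler_norml; lra.
have : `|b| <= pnorm phi x by rewrite ler_norml; lra.
rewrite -(real_normK (num_real a)) -(real_normK (num_real b)).
have := normr_ge0 a; have := normr_ge0 b; nra.
Qed.

(** The power (z^*z)^k is itself of the form v^*v with v bounded by N^k. Such a v is built in steps
    of two, from 1 and z, by multiplying with z^*z on the right. *)
Lemma moment_bound z N k : lbound phi z N ->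
  phi ((star z * z) ^+ k) <= (N ^+ (2 * k))%:C.
Proof.
move=> zN; have tN : lbound phi (star z * z) (N * N).
  by apply: lboundM => //; exact: lbound_star.
have [v [-> vN]] : exists v, (star z * z) ^+ k = star v * v /\ lbound phi v (N ^+ k).
  elim/ltn_ind: k => -[|[|k]] IH.
  - by exists 1; rewrite star1 mul1r; split=> //; exact: lbound1.
  - by exists z.
  - have [v [E vN]] := IH k (leqnSn k.+1).
    exists (v * (star z * z)); rewrite !starM starK; split.
      by rewrite exprSr exprS E !mulrA.
    by rewrite !exprSr -mulrA; exact: lboundM.
have := pos.2 v; have [N0 /(_ 1)] := vN.
have -> : pnorm phi 1 = 1 by rewrite /pnorm /pform star1 mul1r phi1 sqrtr1.
rewrite !mulr1 mulnC exprM => H; rewrite !lecE /= => /andP[/eqP -> _].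
rewrite eqxx /= -/(pform phi v v) -pnorm_sqr //.
by rewrite ler_pXn2r ?nnegrE ?pnorm_ge0.
Qed.

End States.

(** * Matrices *)

Section MatrixStates.
Variables (R : realType) (n : nat).
Local Notation mat := 'M[R[i]]_n.+1.
Local Notation vec := 'cV[R[i]]_n.+1.

Definition vstate (v : vec) (A : mat) : R[i] :=
  (map_mx Num.conj v^T *m A *m v) ord0 ord0.

Lemma Re_conjM (z : R[i]) : (z^*)%R * z = (complex.Re `|z| ^+ 2)%:C.
Proof.
case: z => a b; rewrite [(_^*)%R]/(_ ^*) /= sqr_sqrtr ?addr_ge0 ?sqr_ge0 //.
by rewrite /GRing.mul /=; congr (_ +i* _); ring.
Qed.

Lemma vstate_sqr (v : vec) (A : mat) :
  vstate v (star A * A) = (\sum_i complex.Re `|(A *m v) i ord0| ^+ 2)%:C.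
Proof.
have -> : vstate v (star A * A) =
    (map_mx Num.conj (A *m v)^T *m (A *m v)) ord0 ord0.
  by rewrite /vstate /star /= /mxstar trmx_mul map_mxM !mulmxA.
rewrite mxE rmorph_sum; apply: eq_bigr => i _.
by rewrite [X in X * _]mxE [in X in X * _]mxE; exact: Re_conjM.
Qed.

Lemma vstate_pos (v : vec) : positive_functional (vstate v).
Proof.
split=> [c x y|x].
  by rewrite /vstate mulmxDr mulmxDl -scalemxAr -scalemxAl !mxE.
by rewrite vstate_sqr ler0c sumr_ge0 // => i _; exact: sqr_ge0.
Qed.

Lemma pnorm_vstate (v : vec) (A : mat) : pnorm (vstate v) A = l2norm (A *m v).
Proof. by rewrite /pnorm /pform vstate_sqr. Qed.

Lemma l2norm_ge0 (v : vec) : 0 <= l2norm v. Proof. exact: sqrtr_ge0. Qed.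

Lemma l2normZ (c : R[i]) (v : vec) : l2norm (c *: v) = complex.Re `|c| * l2norm v.
Proof.
rewrite -[v in LHS]mul1mx scalemxAl -(pnorm_vstate v) (pnormZ (vstate_pos v)).
by rewrite pnorm_vstate mul1mx.
Qed.

(** [sup] is meaningful only on a bounded set. Coordinates in the unit ball have modulus at most 1,
    so row sums of moduli bound the entries of the image. *)
Lemma opnorm_has_ub (A : mat) :
  has_ubound [set l2norm (A *m v) | v in [set v : vec | l2norm v <= 1]].
Proof.
exists (Num.sqrt (\sum_i (\sum_j complex.Re `|A i j|) ^+ 2)) => _ [v v1 <-].
rewrite ler_sqrt; last by apply: sumr_ge0 => i _; exact: sqr_ge0.
apply: ler_sum => i _.
rewrite ler_pXn2r ?nnegrE ?Re_norm_ge0 ?sumr_ge0 // => [|j _]; last exact: Re_norm_ge0.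
have vj j : complex.Re `|v j ord0| <= 1.
  rewrite -(ler_pXn2r (n := 2)) ?nnegrE ?Re_norm_ge0 // expr1n.
  have : l2norm v ^+ 2 <= 1 by rewrite expr_le1 ?l2norm_ge0.
  rewrite sqr_sqrtr; last by apply: sumr_ge0 => k _; exact: sqr_ge0.
  apply: le_trans; rewrite (bigD1 j) //= lerDl.
  by apply: sumr_ge0 => k _; exact: sqr_ge0.
have ReD : {morph (@complex.Re R) : x y / x + y} by exact: raddfD.
rewrite mxE -(big_morph _ ReD (erefl : @complex.Re R 0 = 0)).
have Re_le (x y : R[i]) : x <= y -> complex.Re x <= complex.Re y.
  by rewrite lecE => /andP[].
apply: Re_le; apply: le_trans (ler_norm_sum _ _ _) _.
apply: ler_sum => j _; rewrite normrM ler_piMr //.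
have -> : `|v j ord0| = (complex.Re `|v j ord0|)%:C by rewrite RRe_real ?normr_real.
by rewrite lecR.
Qed.

Lemma l2norm_mul_le (A : mat) (v : vec) : l2norm (A *m v) <= opnorm A * l2norm v.
Proof.
have [v0|v0] := eqVneq (l2norm v) 0.
  have -> : v = 0.
    apply/matrixP => i j; rewrite mxE ord1.
    move/eqP: v0; rewrite sqrtr_eq0 => H.
    have S0 : 0 <= \sum_i complex.Re `|v i ord0| ^+ 2.
      by apply: sumr_ge0 => k _; exact: sqr_ge0.
    have /eqP := le_anti (introT andP (conj H S0)).
    rewrite psumr_eq0 => [/allP /(_ i) | k _]; last exact: sqr_ge0.
    rewrite mem_index_enum => /(_ isT); rewrite /= sqrf_eq0 => /eqP e.
    have {}e : complex.Re `|v i ord0| = 0 by exact: e.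
    by apply/eqP; rewrite -normr_eq0 -(RRe_real (normr_real (v i ord0))) e.
  by rewrite mulmx0 -(scale0r 0) l2normZ normr0 !mul0r mulr0.
have vp : 0 < l2norm v by rewrite lt_def v0 l2norm_ge0.
have R1 : complex.Re `|((l2norm v)^-1)%:C : R[i]| = (l2norm v)^-1.
  by rewrite ger0_norm // ler0c invr_ge0 l2norm_ge0.
rewrite -ler_pdivrMr // mulrC -R1 -l2normZ scalemxAr.
apply: ub_le_sup; first exact: opnorm_has_ub.
by exists (((l2norm v)^-1)%:C *: v) => //=; rewrite l2normZ R1 mulVf.
Qed.

(** This converts the bounds of [kaplansky], valid for all positive functionals, into operator norm
    bounds for matrices, and back. *)
Lemma opnorm_leP (A : mat) (s : R) :
  opnorm A <= s <-> forall v, lbound (vstate v) A s.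
Proof.
split=> [As v|H].
  have o0 : 0 <= opnorm A.
    apply: le_trans (ub_le_sup (opnorm_has_ub A) _); last first.
      by exists 0 => //=; rewrite -(scale0r 0) l2normZ normr0 mul0r.
    exact: l2norm_ge0.
  split=> [|w]; first exact: le_trans As.
  rewrite !pnorm_vstate -mulmxA; apply: le_trans (l2norm_mul_le _ _) _.
  by rewrite ler_wpM2r ?l2norm_ge0.
apply: ge_sup => [|_ [v v1 <-]].
  by exists (l2norm (A *m 0)), 0 => //=; rewrite -(scale0r 0) l2normZ normr0 mul0r.
have [s0 /(_ 1)] := H v; rewrite !pnorm_vstate mulr1 mul1mx => /le_trans; apply.
by rewrite ler_piMr.
Qed.

(** As an average of vector functionals, the trace inherits every left bound that they share. *)
Lemma ntr_vstate (A : mat) :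
  ntr A = (n.+1%:R^-1 : R)%:C * \sum_j vstate (delta_mx j ord0) A.
Proof.
rewrite /ntr mulrC fmorphV rmorph_nat; congr (_ * _); apply: eq_bigr => j _.
by rewrite /vstate trmx_delta map_delta_mx -rowE -colE !mxE.
Qed.

Lemma ntr_pos : positive_functional (@ntr R n).
Proof.
split=> [c x y|x]; first by rewrite /ntr linearP /= mulrDl mulrA.
rewrite ntr_vstate mulr_ge0 ?ler0c ?invr_ge0 //.
by apply: sumr_ge0 => j _; exact: (vstate_pos _).2.
Qed.

Lemma ntr_tracial : tracial (@ntr R n).
Proof. by move=> x y; rewrite /ntr mxtrace_mulC. Qed.

Lemma ntr1 : ntr (1 : mat) = 1.
Proof. by rewrite /ntr mxtrace1 divff // pnatr_eq0. Qed.

Lemma pform_ntr (x : mat) : pform (@ntr R n) x x =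
  n.+1%:R^-1 * \sum_j pform (vstate (delta_mx j ord0)) x x.
Proof. by rewrite /pform ntr_vstate ReM_real raddf_sum. Qed.

Lemma lbound_ntr (A : mat) (s : R) : opnorm A <= s -> lbound (@ntr R n) A s.
Proof.
move=> /opnorm_leP H; have [s0 _] := H 0; split=> // w.
rewrite -(ler_pXn2r (n := 2)) ?nnegrE ?mulr_ge0 ?pnorm_ge0 // exprMn.
rewrite !(pnorm_sqr ntr_pos) !pform_ntr mulrCA ler_wpM2l ?invr_ge0 //.
rewrite mulr_sumr; apply: ler_sum => j _.
have pos := vstate_pos (delta_mx j ord0).
rewrite -!(pnorm_sqr pos) -exprMn ler_pXn2r ?nnegrE ?mulr_ge0 ?pnorm_ge0 //.
by have [_] := H (delta_mx j ord0).
Qed.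

Lemma norm2FE (J : choiceType) (F : {fset J}) (x : J -> mat) :
  norm2F F x = Num.sqrt (\sum_(i <- F) pnorm (@ntr R n) (x i) ^+ 2).
Proof.
rewrite /norm2F raddf_sum; congr (Num.sqrt _); apply: eq_bigr => i _.
by rewrite (pnorm_sqr ntr_pos).
Qed.

Lemma pnorm_le_norm2F (J : choiceType) (F : {fset J}) (x : J -> mat) i :
  i \in F -> pnorm (@ntr R n) (x i) <= norm2F F x.
Proof.
move=> iF; rewrite norm2FE -(ler_pXn2r (n := 2)) ?nnegrE ?pnorm_ge0 ?sqrtr_ge0 //.
rewrite [leRHS]sqr_sqrtr; last by apply: sumr_ge0 => k _; exact: sqr_ge0.
rewrite (big_fsetD1 i) //= lerDl.
by apply: sumr_ge0 => k _; exact: sqr_ge0.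
Qed.

(** For k elements the squares add up to at most e^2 k/(k + 1)^2 < e^2; the added 1 also covers
    empty [F]. *)
Lemma norm2F_lt (J : choiceType) (F : {fset J}) (e : R) (x : J -> mat) : 0 < e ->
  (forall i, i \in F -> pnorm (@ntr R n) (x i) <= e / ((size F)%:R + 1)) ->
  norm2F F x < e.
Proof.
move=> e0 H; pose k : R := (size F)%:R; have k0 : 0 <= k by exact: ler0n.
have k1 : 0 < k + 1 by rewrite ltr_wpDl.
have d0 : 0 <= e / (k + 1) by rewrite divr_ge0 ?ltW.
rewrite norm2FE -(ltr_pXn2r (n := 2)) ?nnegrE ?sqrtr_ge0 ?ltW //.
rewrite [ltLHS]sqr_sqrtr; last by apply: sumr_ge0 => j _; exact: sqr_ge0.
apply: (@le_lt_trans _ _ (\sum_(i <- F) (e / (k + 1)) ^+ 2)).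
  rewrite !big_seq; apply: ler_sum => i iF.
  by rewrite ler_pXn2r ?nnegrE ?pnorm_ge0 // H.
rewrite big_const_seq count_predT iter_addr_0 -mulr_natr -/k.
have -> : (e / (k + 1)) ^+ 2 * k = e ^+ 2 * k / (k + 1) ^+ 2.
  by field; rewrite gt_eqF.
rewrite ltr_pdivrMr ?exprn_gt0 // ltr_pM2l ?exprn_gt0 //; nra.
Qed.

End MatrixStates.

(** A neighbourhood is only known to contain the part of an open set inside [Sigma_], so the law of
    a transformed microstate has to be placed there too. *)
Lemma law_mx_Sigma (R : realType) (n : nat) (I : choiceType) (r : I -> R)
    (A : I -> 'M[R[i]]_n.+1) :
  (forall i, opnorm (A i) <= r i) -> Sigma_ r (law_mx A).
Proof.
move=> Ar; split; rewrite /law_mx.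
- by move=> c P Q; rewrite evD evZ (ntr_pos R n).1.
- by rewrite ev1 ntr1.
- move=> P Q; have eP := evM A P Q; have eQ := evM A Q P.
  apply: etrans (congr1 _ eP) _; apply: etrans (ntr_tracial _ _) _.
  by apply: congr1.
- by move=> P; rewrite evM ev_star (ntr_pos R n).2.
- move=> i k; rewrite evX evM ev_star ev_starpolyX.
  by apply: moment_bound; [exact: ntr_pos|exact: ntr1|exact: lbound_ntr].
Qed.

(** * Topology *)

Section PointwiseTopology.

Lemma ptws_cvgP (U : Type) (V : topologicalType) (F : set_system (U -> V))
    (f : U -> V) : Filter F ->
  {ptws, F --> f} <-> forall t, (fun g => g t) @ F --> f t.
Proof.
move=> FF; have surj (i : U) : [set h i | h in [set: U -> V]] = setT.
  by rewrite eqEsubset; split=> v // _; exists (cst v).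
rewrite cvg_sup; split=> H i.
  have := H i; rewrite cvg_image ?surj //; apply: cvg_trans => W /=.
  rewrite ?nbhs_simpl /fmap /= => -[W' + <-].
  by apply: filterS => g W'g /=; exists g.
rewrite cvg_image ?surj // => W /= /H; rewrite ?nbhs_simpl => HW.
exists (@^~ i @^-1` W) => //.
by rewrite eqEsubset; split => [j [? + <-//]|j Wj]; exists (fun _ => j).
Qed.

Lemma near_seq (T : Type) (I : eqType) (F : set_system T) (s : seq I)
    (P : I -> T -> Prop) {FF : Filter F} :
  (forall i, i \in s -> \forall x \near F, P i x) ->
  \forall x \near F, forall i, i \in s -> P i x.
Proof.
elim: s => [|i s IH] H; first exact: filterE.
have Hs : \forall x \near F, forall i, i \in s -> P i x.
  by apply: IH => j js; apply: H; rewrite inE js orbT.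
have Hi := H i (mem_head _ _); near=> x => j; rewrite inE => /orP[/eqP->|].
  exact: (near Hi x).
exact: (near Hs x).
Unshelve. all: by end_near.
Qed.

Variable R : realType.
Local Notation C := R[i].

Lemma pos_complexE (e : C) : 0 < e -> e = (complex.Re e)%:C /\ 0 < complex.Re e.
Proof. by case: e => a b; rewrite ltcE /= => /andP[/eqP -> ?]. Qed.

Variable U : choiceType.
Implicit Types (f g : U -> C) (s : seq U).

(** The sets containing a box around [f] form a filter that converges pointwise to [f], so this
    filter contains every open neighbourhood of [f]. *)
Lemma ptws_nbhs_box (W : set (U -> C)) f : open (W : set {ptws U -> C^o}) -> W f ->
  exists s, exists2 e : R, 0 < e &
    forall g, (forall t, t \in s -> `|g t - f t| < e%:C) -> W g.
Proof.
move=> oW Wf.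
pose F : set_system (U -> C) := [set A | exists s, exists2 e : R, 0 < e &
    forall g, (forall t, t \in s -> `|g t - f t| < e%:C) -> A g].
have FF : Filter F.
  split; first by exists [::], 1.
    move=> A B [s [e e0 HA]] [s' [e' e0' HB]].
    exists (s ++ s'), (Num.min e e') => [|g H]; first by rewrite lt_min e0.
    split; [apply: HA | apply: HB] => t ts.
      by have := H t; rewrite mem_cat ts => /(_ isT)/lt_le_trans; apply;
         rewrite lecR ge_min lexx.
    by have := H t; rewrite mem_cat ts orbT => /(_ isT)/lt_le_trans; apply;
       rewrite lecR ge_min lexx orbT.
  move=> A B AB [s [e e0 HA]]; exists s, e => // g /HA; exact: AB.
suff : {ptws, F --> (f : U -> C^o)} by apply; exact: open_nbhs_nbhs.
apply: (@ptws_cvgP U C^o F f FF).2 => t; apply/(@cvgrPdist_lt C C^o) => e /pos_complexE[-> e0].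
by exists [:: t], (complex.Re e) => // g /(_ t (mem_head _ _)); rewrite distrC.
Qed.

Lemma near_eval f t (c : C) (e : R) : `|f t - c| < e%:C ->
  \forall g \near (f : {ptws U -> C^o}), `|g t - c| < e%:C.
Proof.
move=> fe; have : (fun g : {ptws U -> C^o} => g t) @ (f : {ptws U -> C^o}) --> (f t : C^o).
  exact: (@proj_continuous U (fun=> C^o) t f).
move=> /(@cvgrPdist_lt C C^o) /(_ (e%:C - `|f t - c|)); rewrite subr_gt0 => /(_ fe).
apply: filterS => g; rewrite ltrBrDr distrC; apply: le_lt_trans.
by have := ler_normD (g t - f t) (f t - c); rewrite addrA subrK.
Qed.

Lemma near_eval_seq (I : eqType) (s : seq I) (p : I -> U) (c : I -> C) (e : R) f :
  (forall i, i \in s -> `|f (p i) - c i| < e%:C) ->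
  \forall g \near (f : {ptws U -> C^o}), forall i, i \in s -> `|g (p i) - c i| < e%:C.
Proof.
move=> H; have FF : Filter (nbhs (f : {ptws U -> C^o})) by exact: nbhs_filter.
exact: (@near_seq {ptws U -> C^o} I _ s (fun i g => `|g (p i) - c i| < e%:C) FF
  (fun i iS => near_eval (H i iS))).
Qed.

End PointwiseTopology.

(** * Continuity of polynomial evaluation on matrices *)

Section MatrixContinuity.
Variables (R : realType) (n : nat) (T : Type) (F : set_system T).
Context {FF : Filter F}.
Local Notation C := R[i].
Local Notation mat := 'M[C]_n.+1.

(** Entrywise limits keep the algebra of ['M[C]] apart from the topology carried by ['M[C^o]]. *)
Definition entrywise_cvg (g : T -> mat) (m : mat) : Prop :=
  forall i j, (fun x => g x i j : C^o) @ F --> (m i j : C^o).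

Lemma entrywise_cvgP (g : T -> mat) (m : mat) :
  (g : T -> 'M[C^o]_n.+1) @ F --> (m : 'M[C^o]_n.+1) <-> entrywise_cvg g m.
Proof.
split=> [H i j|H].
  apply: (@cvg_comp _ _ _ g (fun M : 'M[C^o]_n.+1 => M i j) F _ _ H).
  exact: (@coord_continuous C).
apply/(@cvg_ballP C) => e e0.
have : \forall x \near F, forall ij : 'I_n.+1 * 'I_n.+1,
    ball (m ij.1 ij.2 : C^o) e (g x ij.1 ij.2).
  apply: filter_forall => -[i j]; have /(@cvg_ballP C C^o) := H i j; exact.
by apply: filterS => x Hx; split=> // i j; exact: (Hx (i, j)).
Qed.

Lemma entrywise_cvgD g h m p : entrywise_cvg g m -> entrywise_cvg h p ->
  entrywise_cvg (fun x => g x + h x) (m + p).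
Proof.
move=> Hg Hh i j; rewrite mxE; under eq_cvg do rewrite mxE.
exact: (@cvgD C C^o).
Qed.

Lemma entrywise_cvg_cst m : entrywise_cvg (fun=> m) m.
Proof. by move=> i j; exact: cvg_cst. Qed.

Lemma entrywise_cvgM g h m p : entrywise_cvg g m -> entrywise_cvg h p ->
  entrywise_cvg (fun x => g x * h x) (m * p).
Proof.
move=> Hg Hh i j; rewrite mxE; under eq_cvg do rewrite mxE.
apply: (@cvg_big C^o) => [|k _]; last exact: (@cvgM C).
exact: (@pseudometric_normed_Zmodule.add_continuous C C^o).
Qed.

Lemma entrywise_cvgZ c g m : entrywise_cvg g m ->
  entrywise_cvg (fun x => c *: g x) (c *: m).
Proof.
move=> Hg i j; rewrite mxE; under eq_cvg do rewrite mxE.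
by apply: (@cvgM C) => //; exact: cvg_cst.
Qed.

Lemma entrywise_cvg_star g m : entrywise_cvg g m ->
  entrywise_cvg (fun x => star (g x)) (star m).
Proof.
move=> Hg i j; rewrite [star m]/(mxstar m) !mxE.
rewrite /star /= /mxstar; under eq_cvg do rewrite !mxE.
apply/(@cvgrPdist_lt C C^o) => e e0.
have /(@cvgrPdist_lt C C^o)/(_ e e0) := Hg j i; apply: filterS => x.
by rewrite -rmorphB /= norm_conjC.
Qed.

Lemma entrywise_cvg_ev (I : choiceType) (x : T -> I -> mat) (y : I -> mat)
    (P : starpoly C I) : (forall i, entrywise_cvg (x^~ i) (y i)) ->
  entrywise_cvg (fun t => ev (x t) P) (ev y P).
Proof.
move=> H; rewrite /ev; elim: (msupp P : seq _) => [|w s IH].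
  rewrite big_nil (_ : (fun _ => _) = fun=> 0); first exact: entrywise_cvg_cst.
  by apply/funext => t; rewrite big_nil.
rewrite big_cons.
rewrite (_ : (fun _ => _) = fun t => mcoeff w P *: ev_word (x t) w
    + \sum_(w <- s) mcoeff w P *: ev_word (x t) w); last first.
  by apply/funext => t; rewrite big_cons.
apply: entrywise_cvgD IH; apply: entrywise_cvgZ; rewrite /ev_word.
elim: (fmonom_val w) => [|[i b] u IH].
  rewrite big_nil (_ : (fun _ => _) = fun=> 1); first exact: entrywise_cvg_cst.
  by apply/funext => t; rewrite big_nil.
rewrite big_cons (_ : (fun _ => _) = fun t => ev_letter (x t) (i, b)
    * \prod_(s <- u) ev_letter (x t) s); last first.
  by apply/funext => t; rewrite big_cons.
by apply: entrywise_cvgM IH; rewrite /ev_letter /=; case: b => //; exact: entrywise_cvg_star.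
Qed.

End MatrixContinuity.

Lemma continuous_ev (R : realType) (n : nat) (I J : choiceType)
    (T : J -> starpoly R[i] I) :
  continuous ((fun A j => ev A (T j)) :
    {ptws I -> 'M[R[i]^o]_n.+1} -> {ptws J -> 'M[R[i]^o]_n.+1}).
Proof.
move=> A; pose g (B : I -> 'M[R[i]^o]_n.+1) j : 'M[R[i]^o]_n.+1 := ev B (T j).
pose N := nbhs (A : {ptws I -> 'M[R[i]^o]_n.+1}).
have FN : Filter N by exact: nbhs_filter.
have FF : Filter (g @ N) by exact: fmap_filter.
have H := (@ptws_cvgP J 'M[R[i]^o]_n.+1 (g @ N) (g A) FF).2.
apply: H => j.
have := @entrywise_cvg_ev R n {ptws I -> 'M[R[i]^o]_n.+1} (nbhs A) _ I id A (T j).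
move=> H; apply: (iffRL (entrywise_cvgP _ _)); apply: H => i; apply/entrywise_cvgP.
exact: (@proj_continuous I (fun=> 'M[R[i]^o]_n.+1) i A).
Qed.

Lemma within_continuous_comp_subset (T1 T2 T3 : topologicalType) (D1 : set T1)
    (D2 : set T2) (g : T1 -> T2) (f : T2 -> T3) :
  continuous g -> (forall x, D1 x -> D2 (g x)) ->
  {within D2, continuous f} -> {within D1, continuous (f \o g)}.
Proof.
move=> cg gD /subspace_continuousP cf; apply/subspace_continuousP => x Dx.
apply: (@cvg_comp _ _ _ g f (within D1 (nbhs x)) (within D2 (nbhs (g x)))).
  move=> A HA; have H := cg x (fun y => D2 y -> A y) HA.
  apply: (@filterS _ (nbhs x) _ (fun y => D2 (g y) -> A (g y))
    (fun y => D1 y -> A (g y)) _ H) => y Hy Dy.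
  by apply: Hy; exact: gD.
exact: cf (gD _ Dx).
Qed.

(** * Comparison of the mean dimensions *)

(** A Lebesgue number argument: one finite test set and one radius serve all traces. Compactness is
    used on [X] itself, in its near-covering form. *)
Lemma compact_laws (R : realType) (M : cstarAlgType R) (X : set (M -> R[i]))
    (J : choiceType) (x : J -> M) (W : set (starpoly R[i] J -> R[i])) :
  compact (X : set {ptws M -> R[i]^o}) ->
  open (W : set {ptws starpoly R[i] J -> R[i]^o}) -> laws X x `<=` W ->
  exists S : seq (starpoly R[i] J), exists2 e : R, 0 < e &
    forall tau l, X tau -> (forall P, P \in S -> `|l P - tau (ev x P)| < e%:C) -> W l.
Proof.
move=> /compact_near_coveringP Xc oW XW.
pose I := (seq (starpoly R[i] J) * R)%type.
(* The filter of eventually large test sets and small radii. *)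
pose F : set_system I := fun A : set I => exists S : seq (starpoly R[i] J),
  exists2 e : R, 0 < e &
  forall (S' : seq (starpoly R[i] J)) (e' : R), {subset S <= S'} -> 0 < e' <= e -> A (S', e').
pose good (i : I) (tau : M -> R[i]) := forall l,
  (forall P, P \in i.1 -> `|l P - tau (ev x P)| < (i.2)%:C) -> W l.
have FF : Filter F.
  split; first by exists [::], 1.
    move=> A B [S [e e0 HA]] [S' [e' e0' HB]].
    exists (S ++ S'), (Num.min e e') => [|T d ST /andP[d0]]; first by rewrite lt_min e0.
    rewrite le_min => /andP[de de']; split.
      by apply: HA; rewrite ?d0 // => P PS; apply: ST; rewrite mem_cat PS.
    by apply: HB; rewrite ?d0 // => P PS; apply: ST; rewrite mem_cat PS orbT.
  by move=> A B AB [S [e e0 HA]]; exists S, e => // S' e' SS ee; exact/AB/HA.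
have cover tau : X tau ->
    \forall tau' \near (tau : {ptws M -> R[i]^o}) & i \near F, good i tau'.
  move=> Xt; have Wt : W (tau \o ev x) by apply: XW; exists tau.
  have [S [e e0 HS]] := ptws_nbhs_box oW Wt.
  (* Half of the radius is spent on replacing [tau] by a nearby [tau'], half on [l]. *)
  have e2 : 0 < e / 2 by rewrite divr_gt0.
  have near_tau : \forall tau' \near (tau : {ptws M -> R[i]^o}),
      forall P, P \in S -> `|tau' (ev x P) - tau (ev x P)| < (e / 2)%:C.
    by apply: near_eval_seq => P _; rewrite subrr normr0 ltcR.
  exists ([set tau' : M -> R[i] | forall P, P \in S ->
       `|tau' (ev x P) - tau (ev x P)| < (e / 2)%:C],
     [set i : I | {subset S <= i.1} /\ i.2 <= e / 2]).
    split; first exact: near_tau.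
    by exists S, (e / 2) => // S' e' SS /andP[_ ?].
  move=> [tau' [S' e']] /= [Ht [SS ee]] l Hl; apply: HS => P PS.
  rewrite (splitr e) rmorphD.
  have -> : l P - (tau \o ev x) P =
      (l P - tau' (ev x P)) + (tau' (ev x P) - tau (ev x P)).
    by rewrite addrA subrK.
  apply: le_lt_trans (ler_normD _ _) _; apply: ltrD; last exact: Ht.
  by apply: lt_le_trans (Hl P (SS _ PS)) _; rewrite lecR.
have [S [e e0 HS]] := Xc I F good FF cover.
exists S, e => // tau l Xt; apply: (HS S e) => //.
by rewrite e0 lexx.
Qed.

Section TransferDimension.
Variables (R : realType) (I1 I2 I3 I1' I2' I3' : choiceType).
Local Notation J := (I1 + I2 + I3)%type.
Local Notation J' := (I1' + I2' + I3')%type.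

(** A map into a complex is pulled back along [Phi], with the same complex. Closeness over [G]
    yields closeness over [G'], which makes the injectivity of the given map available. *)
Lemma dim_approx_le (n : nat) (eps : R) (F : {fset I1}) (theta : R) (G : {fset I2})
    (eps' : R) (F' : {fset I1'}) (theta' : R) (G' : {fset I2'})
    (D : set (J -> 'M[R[i]]_n.+1)) (D' : set (J' -> 'M[R[i]]_n.+1))
    (Phi : {ptws J -> 'M[R[i]^o]_n.+1} -> {ptws J' -> 'M[R[i]^o]_n.+1}) :
  continuous Phi -> (forall x, D x -> D' (Phi x)) ->
  (forall x y : J -> 'M[R[i]]_n.+1, D x -> D y ->
    norm2F G (fun j => x (inl (inr j)) - y (inl (inr j))) < theta ->
    norm2F G' (fun j => (Phi x (inl (inr j)) - Phi y (inl (inr j))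
      : 'M[R[i]]_n.+1)) < theta' /\
    (norm2F F' (fun j => (Phi x (inl (inl j)) - Phi y (inl (inl j)) : 'M[R[i]]_n.+1)) < eps' ->
     norm2F F (fun j => x (inl (inl j)) - y (inl (inl j))) < eps)) ->
  (dim_approx eps F theta G D <= dim_approx eps' F' theta' G' D')%E.
Proof.
move=> Phic DD H; apply: le_ereal_inf_tmp => _ [d [V [K [f [Kd fc finj]]]] <-].
apply: ereal_inf_lbound; exists d => //; exists V, K, (f \o Phi); split=> //.
  exact: within_continuous_comp_subset Phic DD fc.
move=> x y Dx Dy fxy xy; have [xy' ] := H x y Dx Dy xy; apply.
exact: finj (DD _ Dx) (DD _ Dy) fxy xy'.
Qed.

Lemma md_nbhd_le (r : J -> R) (r' : J' -> R)
    (eps : R) (F : {fset I1}) (theta : R) (G : {fset I2})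
    (eps' : R) (F' : {fset I1'}) (theta' : R) (G' : {fset I2'}) O O' :
  (forall n, dim_approx eps F theta G (microstates (n := n) r O) <=
             dim_approx eps' F' theta' G' (microstates (n := n) r' O'))%E ->
  (md_nbhd r eps F theta G O <= md_nbhd r' eps' F' theta' G' O')%E.
Proof.
move=> H; apply: le_ereal_inf_tmp => _ [V HV <-].
apply: ge_ereal_inf; eexists; first by exists V => //; reflexivity.
apply: ge_ereal_sup => _ [n Vn <-]; apply: le_ereal_sup_tmp.
eexists; first by exists n => //; reflexivity.
by apply: lee_wpmul2l => //; rewrite lee_fin invr_ge0 exprn_ge0.
Qed.

End TransferDimension.

Lemma unif_continuous_ev_seq (R : realType) (I : choiceType) (r : I -> R)
    (K : eqType) (s : seq K) (Q : K -> starpoly R[i] I) (e : R) :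
  (forall i, 0 <= r i) -> 0 < e ->
  exists V : seq I, exists2 d : R, 0 < d &
  forall (A : starAlgType R[i]) (phi : A -> R[i]) (x y : I -> A),
    positive_functional phi -> tracial phi ->
    (forall i, lbound phi (x i) (r i)) -> (forall i, lbound phi (y i) (r i)) ->
    (forall i, i \in V -> pnorm phi (x i - y i) <= d) ->
    forall k, k \in s -> pnorm phi (ev x (Q k) - ev y (Q k)) <= e.
Proof.
move=> r0 e0; elim: s => [|k s [V [d d0 H]]]; first by exists [::], 1.
have [V' [d' d0' H']] := unif_continuous_ev r0 (Q k) e0.
exists (V' ++ V), (Num.min d' d) => [|A phi x y pos tr xr yr xy j]; first by rewrite lt_min d0'.
rewrite inE => /orP[/eqP ->|].
  apply: H' => // i iV; apply: le_trans (xy i _) _; first by rewrite mem_cat iV.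
  by rewrite ge_min lexx.
apply: (H A phi x y) => // i iV; apply: le_trans (xy i _) _.
  by rewrite mem_cat iV orbT.
by rewrite ge_min lexx orbT.
Qed.

(** The error budget of [md_eps_transfer]: k/8 for approximating a by [Q], k/8 for perturbing the
    arguments of [Q], k/3 for the defect allowed on each of two microstates. *)
Lemma fraction_sums (R : realType) (k : R) : 0 < k ->
  [/\ k / 8 + k / 8 = k / 4, k / 4 + k / 4 < k, k / 4 < k / 3
    & k / 3 + k / 8 + k / 3 <= k].
Proof. by move=> k0; split; lra. Qed.

(** * The transfer of microstates *)

Section Main.
Variables (R : realType) (M : cstarAlgType R) (X : set (M -> R[i])).
Hypothesis hX : tracially_complete X.
Variables (I1 I2 I3 I1' I2' I3' : choiceType).
Variables (a : I1 -> M) (b : I2 -> M) (c : I3 -> M).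
Variables (a' : I1' -> M) (b' : I2' -> M) (c' : I3' -> M).
Local Notation J := (I1 + I2 + I3)%type.
Local Notation J' := (I1' + I2' + I3')%type.
Variables (r : J -> R) (r' : J' -> R).
Local Notation x := (concat (concat a b) c).
Local Notation x' := (concat (concat a' b') c').
Hypotheses (hr : cutoff r x) (hr' : cutoff r' x').
Hypothesis hb : cstarX X b' `<=` cstarX X b.
Hypothesis hab : cstarX X (concat a b) `<=` cstarX X (concat a' b').
Hypothesis habc : cstarX X x' `<=` cstarX X x.

Lemma cstarX_gen (I : choiceType) (y : I -> M) i : cstarX X y (y i).
Proof. by rewrite -(ev_starpolyX y i); exact: cstarX_ev. Qed.

Lemma state_lbound (I : choiceType) (y : I -> M) (s : I -> R) tau i :
  (forall j, cnorm (y j) <= s j) -> X tau -> lbound tau (y i) (s i).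
Proof.
by move=> ys Xt; apply: lbound_le (ys i) _; apply: lbound_cnorm; exact: (state_pos hX).
Qed.

(** Density is applied to (a, b, c) in general and to b alone for the letters of b'; the latter
    polynomials are then renamed into the full set of variables. *)
Lemma approximating_polynomials (e : R) : 0 < e -> exists T : J' -> starpoly R[i] J,
  [/\ forall j tau, X tau -> pnorm tau (x' j - ev x (T j)) <= e,
      forall j (A : starAlgType R[i]) (phi : A -> R[i]) (z : J -> A),
        positive_functional phi -> (forall i, lbound phi (z i) (r i)) ->
        lbound phi (ev z (T j)) (r' j)
    & exists P : I2' -> starpoly R[i] I2, forall j,
        T (inl (inr j)) = ev (fun i => starpolyX R[i] (inl (inr i) : J)) (P j)].
Proof.
move=> e0.
have HT j := kaplansky hX hr.2 (hr'.2 j) (habc (cstarX_gen x' j)) e0.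
have [T0 HT0] := choice HT.
have HP j := kaplansky hX (fun i => hr.2 (inl (inr i))) (hr'.2 (inl (inr j)))
  (hb (cstarX_gen b' j)) e0.
have [P HP0] := choice HP.
exists (fun j => if j is inl (inr i) then
    ev (fun i => starpolyX R[i] (inl (inr i) : J)) (P i) else T0 j).
have evP (A : starAlgType R[i]) (z : J -> A) i :
    ev z (ev (fun i => starpolyX R[i] (inl (inr i) : J)) (P i)) =
    ev (fun i => z (inl (inr i))) (P i).
  by rewrite ev_comp; congr ev; apply/funext => k; rewrite ev_starpolyX.
split; last by exists P.
- move=> [[j|j]|j] tau Xt; [exact: (HT0 _).1 | | exact: (HT0 _).1].
  by rewrite evP; exact: (HP0 j).1.
- move=> [[j|j]|j] A phi z pos zr; [exact: (HT0 _).2 | | exact: (HT0 _).2].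
  by rewrite evP; apply: (HP0 j).2.
Qed.

(** For a fixed trace the inequalities define an open set, and the quantifier over [tau] is a union
    of such sets. *)
Lemma transfer_nbhd (I0 : eqType) (T : J' -> starpoly R[i] J)
    (S : seq (starpoly R[i] J')) (eta : R) (s : seq I0) (D : I0 -> starpoly R[i] J)
    (k : R) :
  (forall tau P, X tau -> P \in S -> `|tau (ev x (ev T P)) - tau (ev x' P)| < eta%:C) ->
  (forall tau i, X tau -> i \in s -> `|tau (ev x (D i))| < k%:C) ->
  weak_nbhd r (laws X x) [set l | Sigma_ r l /\
    (exists2 tau, X tau & forall P, P \in S -> `|l (ev T P) - tau (ev x' P)| < eta%:C) /\
    forall i, i \in s -> `|l (D i)| < k%:C].
Proof.
move=> HS HD; split; first by move=> l [].
exists [set l | (exists2 tau, X tau &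
    forall P, P \in S -> `|l (ev T P) - tau (ev x' P)| < eta%:C) /\
    forall i, i \in s -> `|l (D i)| < k%:C]; split.
- rewrite openE => l [[tau Xt lS] lD].
  have FF : Filter (nbhs (l : {ptws starpoly R[i] J -> R[i]^o})) by exact: nbhs_filter.
  have near1 : \forall l' \near (l : {ptws starpoly R[i] J -> R[i]^o}),
      forall P, P \in S -> `|l' (ev T P) - tau (ev x' P)| < eta%:C.
    by apply: near_eval_seq => P PS; exact: lS.
  have near2 : \forall l' \near (l : {ptws starpoly R[i] J -> R[i]^o}),
      forall i, i \in s -> `|l' (D i)| < k%:C.
    have lD0 i : i \in s -> `|l (D i) - 0| < k%:C by move=> iS; rewrite subr0 lD.
    have := @near_eval_seq R _ _ s D (fun=> 0) k l lD0.
    by apply: (@filterS _ _ FF) => g Hg i iS; have := Hg i iS; rewrite subr0.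
  have : \forall l' \near (l : {ptws starpoly R[i] J -> R[i]^o}),
     (forall P, P \in S -> `|l' (ev T P) - tau (ev x' P)| < eta%:C) /\
     (forall i, i \in s -> `|l' (D i)| < k%:C) by exact: (@filterI _ _ FF _ _ near1 near2).
  by apply: (@filterS _ _ FF) => l' [l1 l2]; split=> //; exists tau.
- move=> _ [tau Xt <-]; split; last by move=> i iS; exact: HD.
  by exists tau => // P PS; exact: HS.
- by move=> l [[]].
Qed.

(** [eps'] and [F'] must be fixed before [theta'], [G'] and the neighbourhood are given, hence
    before [T]. They come from a modulus of continuity of [Q] that is uniform over all tuples within
    the cutoffs, and so applies to the later [T]. *)
Lemma md_eps_transfer (eps : R) (F : {fset I1}) : 0 < eps ->
  exists2 eps' : R, 0 < eps' & exists F' : {fset I1'},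
    (md_eps X r a b c eps F <= md_eps X r' a' b' c' eps' F')%E.
Proof.
move=> eps0; pose k := eps / ((size F)%:R + 1).
have k0 : 0 < k by rewrite divr_gt0 // ltr_wpDl.
have [k88 _ k43 k383] := fraction_sums k0.
have k3 : 0 <= k / 3 by rewrite divr_ge0 // ltW.
have k8 : 0 < k / 8 by rewrite divr_gt0.
pose x12 := concat a' b'; pose r12 (i : I1' + I2') := r' (inl i).
have r12_ge0 i : 0 <= r12 i by exact: hr'.1.
have /choice[Q HQ] i : exists P : starpoly R[i] (I1' + I2')%type,
    forall tau, X tau -> pnorm tau (a i - ev x12 P) <= k / 8.
  by apply: (cstarXP hX _ _).1 k8; apply: hab; exact: (cstarX_gen (concat a b) (inl i)).
have [V [d d0 HV]] := unif_continuous_ev_seq (F : seq I1) Q r12_ge0 k8.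
(* The letters on which the modulus of [Q] depends are split: those of a' form [F'], those of b'
   form [GV] and are controlled through b. *)
pose F' : {fset I1'} :=
  [fset j in pmap (fun s : I1' + I2' => if s is inl j then Some j else None) V]%fset.
pose GV : {fset I2'} :=
  [fset j in pmap (fun s : I1' + I2' => if s is inr j then Some j else None) V]%fset.
have F'V j : inl j \in V -> j \in F'.
  by move=> jV; rewrite in_fset /= mem_pmap; apply/mapP; exists (inl j).
have GVV j : inr j \in V -> j \in GV.
  by move=> jV; rewrite in_fset /= mem_pmap; apply/mapP; exists (inr j).
exists d => //; exists F'.
apply: le_ereal_inf_tmp => _ [[theta' G'] /= theta'0 <-].
apply: le_ereal_inf_tmp => _ [N1 [N1sub [W1 [oW1 lW1 WN1]]] <-].
have [S [eta eta0 HS]] := compact_laws (tc_compact hX) oW1 lW1.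
(* A quarter absorbs the factor 2 of [norm_phi_le] and leaves a strict inequality. *)
have eta4 : 0 < eta / 4 by rewrite divr_gt0.
have [VS [dS dS0 HVS]] := unif_continuous_ev_seq S id hr'.1 eta4.
(* Tolerance [d] keeps the values of [Q] close, tolerance [dS] keeps the moments in [S] close. *)
have e0 : 0 < Num.min d dS by rewrite lt_min d0.
have [T [Tx Tr [P TP]]] := approximating_polynomials e0.
(* The first bound serves the letters of b' inside [Q], the second the norm over [G']. *)
pose vt := Num.min d (theta' / ((size G')%:R + 1)).
have vt0 : 0 < vt by rewrite lt_min d0 divr_gt0 // ltr_wpDl.
have [G0 [theta theta0 HG]] := unif_continuous_ev_seq (G' ++ GV) P
  (fun j => hr.1 (inl (inr j))) vt0.
pose G : {fset I2} := [fset j in G0]%fset.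
pose QQ i : starpoly R[i] J' := ev (fun j => starpolyX R[i] (inl j : J')) (Q i).
have evQQ (A : starAlgType R[i]) (z : J' -> A) i : ev z (QQ i) = ev (fun j => z (inl j)) (Q i).
  by rewrite ev_comp; congr ev; apply/funext => j; rewrite ev_starpolyX.
(* The defect of recovering a from T(a, b, c) through [Q]; its smallness on microstates makes A
   recoverable from T(A). *)
pose D i : starpoly R[i] J := ev T (QQ i) - starpolyX R[i] (inl (inl i) : J).
have evD0 (A : starAlgType R[i]) (z : J -> A) i :
    ev z (D i) = ev (fun j => ev z (T (inl j))) (Q i) - z (inl (inl i)).
  by rewrite evB ev_comp evQQ ev_starpolyX.
(* A law sees the seminorm of the defect only through this square, hence the squared threshold
   below. *)
pose DD i := star (D i) * D i.
have HO := @transfer_nbhd _ T S eta F DD ((k / 3) ^+ 2).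
set O := (X in weak_nbhd _ _ X) in HO.
have Tlb tau j : X tau -> lbound tau (ev x (T j)) (r' j).
  move=> Xt; apply: Tr; first exact: (state_pos hX).
  by move=> i; apply: (state_lbound _ hr.2).
have {}HO : weak_nbhd r (laws X x) O.
  have Txs tau j : X tau -> pnorm tau (ev x (T j) - x' j) <= Num.min d dS.
    by move=> Xt; rewrite -(pnormN (state_pos hX Xt)) opprB Tx.
  apply: HO => [tau p Xt pS|tau i Xt iF]; have pos := state_pos hX Xt.
    have [_ tau1 _ _] := tc_tracial hX Xt.
    rewrite -(positive_functionalB pos) ev_comp.
    apply: le_lt_trans (norm_phi_le pos tau1 _) _; rewrite ltcR mulr2n.
    have := HVS M tau (fun j => ev x (T j)) x' pos (state_tracial hX Xt)
      (fun j => Tlb tau j Xt) (fun j => state_lbound j hr'.2 Xt) _ p pS.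
    have dSle j : j \in VS -> pnorm tau (ev x (T j) - x' j) <= dS.
      by move=> _; apply: le_trans (Txs tau j Xt) _; rewrite ge_min lexx orbT.
    move=> /(_ dSle) H; apply: le_lt_trans (lerD H H) _.
    by have [] := fraction_sums eta0.
  have dle j : j \in V -> pnorm tau (ev x (T (inl j)) - x12 j) <= d.
    by move=> _; apply: le_trans (Txs tau (inl j) Xt) _; rewrite ge_min lexx.
  have H1 := HV M tau (fun j => ev x (T (inl j))) x12 pos (state_tracial hX Xt)
    (fun j => Tlb tau (inl j) Xt) (fun j => state_lbound (inl j) hr'.2 Xt) dle i iF.
  have H2 : pnorm tau (ev x (D i)) <= k / 4.
    rewrite evD0; have := HQ i tau Xt; rewrite -(pnormN pos) opprB => H3.
    have := pnormD pos (ev (fun j => ev x (T (inl j))) (Q i) - ev x12 (Q i))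
      (ev x12 (Q i) - a i).
    by rewrite subrKA => /le_trans; apply; rewrite -k88 lerD.
  rewrite /DD evM ev_star (positive_functional_sqr pos).
  rewrite ger0_norm ?ler0c ?sqr_ge0 // ltcR ltr_pXn2r ?nnegrE ?pnorm_ge0 //.
  exact: le_lt_trans H2 _.
apply: ge_ereal_inf; exists (md_theta X r a b c eps F theta G).
  by exists (theta, G).
apply: ge_ereal_inf; exists (md_nbhd r eps F theta G O); first by exists O.
apply: md_nbhd_le => n.
apply: (@dim_approx_le R I1 I2 I3 I1' I2' I3' n eps F theta G d F' theta' G' _ _ _
  (@continuous_ev R n J J' T)) => [A [Ar [_ [[tau Xt AS] _]]]|A B].
  (* All vector functionals together turn the uniform bound on [T] into the exact operator norm
     cutoff. *)
  have evr j : opnorm (ev A (T j)) <= r' j.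
    apply/opnorm_leP => v; apply: Tr; first exact: vstate_pos.
    by move=> i; exact: (opnorm_leP _ _).1 (Ar i) v.
  split=> //; apply: WN1; split; last exact: law_mx_Sigma.
  by apply: HS Xt _ => p pS; have := AS p pS; rewrite /law_mx ev_comp.
move=> [Ar [_ [_ AD]]] [Br [_ [_ BD]]] AB.
have pos := ntr_pos R n; have tr := @ntr_tracial R n.
have lbT (A' : J -> 'M[R[i]]_n.+1) : (forall i, opnorm (A' i) <= r i) ->
    forall j, lbound (@ntr R n) (ev A' (T j)) (r' j).
  by move=> A'r j; apply: Tr => // i; exact: lbound_ntr.
have vtle j : j \in G' ++ GV ->
    pnorm (@ntr R n) (ev A (T (inl (inr j))) - ev B (T (inl (inr j)))) <= vt.
  have evXE (A' : J -> 'M[R[i]]_n.+1) :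
      (fun i => ev A' (starpolyX R[i] (inl (inr i) : J))) = (fun i => A' (inl (inr i))).
    by apply/funext => i; rewrite ev_starpolyX.
  move=> jG; rewrite !TP !ev_comp !evXE.
  apply: (HG _ _ (fun i => A (inl (inr i))) (fun i => B (inl (inr i))) pos tr) => //.
  - by move=> i; exact: lbound_ntr.
  - by move=> i; exact: lbound_ntr.
  move=> i iG; apply: le_trans (ltW AB).
  by apply: (pnorm_le_norm2F (fun i => A (inl (inr i)) - B (inl (inr i)))); rewrite in_fset.
split.
  apply: norm2F_lt => // j jG; apply: le_trans (vtle j _) _.
    by rewrite mem_cat jG.
  by rewrite ge_min lexx orbT.
move=> ABF; apply: norm2F_lt => // i iF.
have near_Q (A' : J -> 'M[R[i]]_n.+1) :
    (forall i, i \in (F : seq _) -> `|law_mx A' (DD i)| < ((k / 3) ^+ 2)%:C) ->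
    pnorm (@ntr R n) (ev A' (D i)) <= k / 3.
  move=> /(_ i iF); rewrite /law_mx /DD evM ev_star (positive_functional_sqr pos).
  rewrite ger0_norm ?ler0c ?sqr_ge0 // ltcR ltr_pXn2r ?nnegrE ?pnorm_ge0 //.
  by move/ltW.
have HA := near_Q A AD; have HB := near_Q B BD.
(* Letters of a' are close by the injectivity in the target, letters of b' by closeness of the
   b-parts. *)
have dle j : j \in V -> pnorm (@ntr R n) (ev A (T (inl j)) - ev B (T (inl j))) <= d.
  case: j => j jV.
    apply: le_trans (ltW ABF).
    exact: (pnorm_le_norm2F (fun j =>
      ev A (T (inl (inl j))) - ev B (T (inl (inl j)))) (F'V j jV)).
  apply: le_trans (vtle j _) _; first by rewrite mem_cat GVV ?orbT.
  by rewrite ge_min lexx.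
have HAB := HV _ _ (fun j => ev A (T (inl j))) (fun j => ev B (T (inl j))) pos tr
  (fun j => lbT A Ar (inl j)) (fun j => lbT B Br (inl j)) dle i iF.
rewrite evD0 in HA; rewrite evD0 in HB.
set qA := ev _ (Q i) in HA HAB; set qB := ev _ (Q i) in HB HAB.
(* Both defects and the difference of the values of [Q] add up to k/3 + k/8 + k/3. *)
have -> : A (inl (inl i)) - B (inl (inl i)) =
    - (qA - A (inl (inl i))) + (qA - qB) + (qB - B (inl (inl i))).
  by rewrite opprB !subrKA.
have AQ : pnorm (@ntr R n) (- (qA - A (inl (inl i))) + (qA - qB)) <= k / 3 + k / 8.
  by apply: le_trans (pnormD pos _ _) _; rewrite (pnormN pos) lerD.
apply: le_trans (le_trans (pnormD pos _ _) (lerD AQ HB)) _.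
by [].
Qed.

End Main.

Theorem theorem3p8 (R : realType) (M : cstarAlgType R) (X : set (M -> R[i]))
  (hX : tracially_complete X)
  (I1 I2 I3 I1' I2' I3' : choiceType)
  (a : I1 -> M) (b : I2 -> M) (c : I3 -> M)
  (a' : I1' -> M) (b' : I2' -> M) (c' : I3' -> M)
  (r : I1 + I2 + I3 -> R) (r' : I1' + I2' + I3' -> R)
  (hr : cutoff r (concat (concat a b) c))
  (hr' : cutoff r' (concat (concat a' b') c'))
  (hb : cstarX X b' `<=` cstarX X b)
  (hab : cstarX X (concat a b) `<=` cstarX X (concat a' b'))
  (habc : cstarX X (concat (concat a' b') c') `<=`
          cstarX X (concat (concat a b) c)) :
  (delta_MD X r a b c <= delta_MD X r' a' b' c')%E.
Proof.
apply: ge_ereal_sup => _ [[eps F] /= eps0 <-].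
have [eps' eps'0 [F' H]] := md_eps_transfer hX hr hr' hb hab habc F eps0.
by apply: le_ereal_sup_tmp; exists (md_eps X r' a' b' c' eps' F') => //; exists (eps', F').
Qed.
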